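(* Let $R$ be a real affine algebra of Krull dimension $d\ge 2$ such that either $R$ has no real maximal ideals, or the intersection of all real maximal ideals of $R$ has height at least $1$. Then the abelian group $\mathrm{WMS}_{d+1}(R)$ has a nice group structure; that is, for any $(a,a_1,\ldots,a_d)$ and $(b,a_1,\ldots,a_d)$ in $\mathrm{Um}_{d+1}(R)$ one has $$[(a,a_1,\ldots,a_d)]\star[(b,a_1,\ldots,a_d)]=[(ab,a_1,\ldots,a_d)].$$ In particular, $\mathrm{WMS}_{d+1}(R)\cong\mathrm{MS}_{d+1}(R)$ (via the canonical surjection $\mathrm{WMS}_{d+1}(R)\to\mathrm{MS}_{d+1}(R)$).
   Context: A real affine algebra is a finitely generated commutative $\mathbb R$-algebra; a maximal ideal $\mathfrak m$ is real if $R/\mathfrak m\cong\mathbb R$. For a commutative noetherian ring $A$, $\mathrm{Um}_{n}(A)$ is the set of unimodular rows of length $n$ (rows whose entries generate the unit ideal) and $\mathrm E_n(A)$ is the group generated by elementary matrices, acting on $\mathrm{Um}_n(A)$ on the right. Mennicke symbol of length $n+1\ge3$: a pair $(\psi,G)$ with $G$ a group and $\psi:\mathrm{Um}_{n+1}(A)\to G$ such that (1) $\psi((0,\dots,0,1))=1$ and $\psi(v)=\psi(v\epsilon)$ for $\epsilon\in \mathrm E_{n+1}(A)$; (2) $\psi((b_1,\dots,b_n,x))\psi((b_1,\dots,b_n,y))=\psi((b_1,\dots,b_n,xy))$ for any two unimodular rows $(b_1,\dots,b_n,x)$, $(b_1,\dots,b_n,y)$. Weak Mennicke symbol of length $n+1\ge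 3$: a pair $(\phi,G)$ with $G$ a group and $\phi:\mathrm{Um}_{n+1}(A)\to G$ such that (1) $\phi(1,0,\dots,0)=1$ and $\phi(v)=\phi(v\epsilon)$ for $\epsilon\in\mathrm E_{n+1}(A)$; (2) $\phi(a,a_1,\dots,a_n)\phi(1-a,a_1,\dots,a_n)=\phi(a(1-a),a_1,\dots,a_n)$ whenever $(a,a_1,\dots,a_n)$ and $(1-a,a_1,\dots,a_n)$ are unimodular. $\mathrm{MS}_{n+1}(A)$ and $\mathrm{WMS}_{n+1}(A)$ are the target groups of the universal Mennicke symbol and universal weak Mennicke symbol. If $A$ has dimension $n\ge2$, by Vaserstein and van der Kallen the orbit set $\mathrm{Um}_{n+1}(A)/\mathrm E_{n+1}(A)$ carries an abelian group structure (with operation $\star$) which coincides with $\mathrm{WMS}_{n+1}(A)$; $[v]$ denotes the elementary orbit of $v$. *)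

(* Defs.v *)
From HB Require Import structures.
From mathcomp Require Import all_boot all_order all_algebra.
From mathcomp Require Import ring_quotient.
From mathcomp Require Import all_classical all_reals.

Set Implicit Arguments.
Unset Strict Implicit.
Unset Printing Implicit Defensive.

Import GRing.Theory.

Local Open Scope classical_set_scope.
Local Open Scope ring_scope.

(* The ideals [idealr A] and [prime_idealr A] of the library are the proper
   (resp. prime) ideals of A given by boolean predicates; in the presence of
   the classical axioms these are all the proper (resp. prime) ideals. *)
Section CommutativeAlgebra.
Variable A : comNzRingType.

(* P 0 < P 1 < ... < P n; the values of P beyond n are irrelevant. *)
Definition prime_chain (n : nat) (P : nat -> prime_idealr A) : Prop :=
  forall i, (i < n)%N ->
    {subset P i <= P i.+1} /\ ~ {subset P i.+1 <= P i}.

Definition krull_dim (d : nat) : Prop :=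
  (exists P, prime_chain d P) /\ (forall n P, prime_chain n P -> (n <= d)%N).

Definition prime_height_ge (p : prime_idealr A) (h : nat) : Prop :=
  exists P, prime_chain h P /\ P h =i p.

(* The height of an ideal is the infimum of the heights of the primes
   containing it (infinite for the unit ideal). *)
Definition height_ge (I : set A) (h : nat) : Prop :=
  forall p : prime_idealr A, (forall x, I x -> x \in p) -> prime_height_ge p h.

Definition maximal_ideal (m : idealr A) : Prop :=
  forall I : idealr A, {subset m <= I} -> {subset I <= m}.

End CommutativeAlgebra.

Section RealAlgebra.
Variables (R : realType) (A : comAlgType R).

Definition finitely_generated_algebra : Prop :=
  exists s : seq A, forall S : {pred A},
    GRing.subalg_closed S -> {subset s <= S} -> forall x, x \in S.

(* A ring isomorphism A / m -> R is automatically R-linear, the identity being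
   the only ring endomorphism of R. *)
Definition real_maximal_ideal (m : idealr A) : Prop :=
  maximal_ideal m /\
  exists f : {rmorphism {ideal_quot m} -> R}, bijective f.

Definition real_maximal_intersection : set A :=
  [set x | forall m : idealr A, real_maximal_ideal m -> x \in m].

End RealAlgebra.

Arguments finitely_generated_algebra {R} A.
Arguments real_maximal_intersection {R} A.

Section UnimodularRows.
Variable A : comNzRingType.

Definition Um (n : nat) : set 'rV[A]_n :=
  [set v | exists w : 'I_n -> A, \sum_i v 0 i * w i = 1].

Inductive elementary_group (n : nat) : set 'M[A]_n :=
| Elem_gen (i j : 'I_n) (a : A) :
    i != j -> elementary_group (1%:M + a *: delta_mx i j)
| Elem_1 : elementary_group 1%:M
| Elem_mul (e e' : 'M[A]_n) :
    elementary_group e -> elementary_group e' -> elementary_group (e *m e')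
| Elem_inv (e e' : 'M[A]_n) :
    elementary_group e -> e *m e' = 1%:M -> elementary_group e'.

(* (a, t_1, ..., t_n) *)
Definition row_cons (n : nat) (a : A) (t : 'rV[A]_n) : 'rV[A]_n.+1 :=
  \row_i (if unlift ord0 i is Some j then t 0 j else a).

(* (t_1, ..., t_n, a) *)
Definition row_rcons (n : nat) (t : 'rV[A]_n) (a : A) : 'rV[A]_n.+1 :=
  \row_i (if unlift ord_max i is Some j then t 0 j else a).

(* A symbol is a total function on rows, of which only the restriction to
   Um is ever considered. The definitions are meant for n >= 2. *)
Definition Mennicke_symbol (n : nat) (G : groupType)
    (psi : 'rV[A]_n.+1 -> G) : Prop :=
  [/\ psi (row_rcons 0 1) = 1%g,
      forall v e, Um v -> elementary_group e -> psi v = psi (v *m e)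
    & forall b x y, Um (row_rcons b x) -> Um (row_rcons b y) ->
      (psi (row_rcons b x) * psi (row_rcons b y))%g = psi (row_rcons b (x * y))].

Definition weak_Mennicke_symbol (n : nat) (G : groupType)
    (phi : 'rV[A]_n.+1 -> G) : Prop :=
  [/\ phi (row_cons 1 0) = 1%g,
      forall v e, Um v -> elementary_group e -> phi v = phi (v *m e)
    & forall a t, Um (row_cons a t) -> Um (row_cons (1 - a) t) ->
      (phi (row_cons a t) * phi (row_cons (1 - a) t))%g
        = phi (row_cons (a * (1 - a)) t)].

Definition universal_symbol (n : nat)
    (symbol : forall G : groupType, ('rV[A]_n -> G) -> Prop)
    (G : groupType) (phi : 'rV[A]_n -> G) : Prop :=
  symbol G phi /\
  forall (H : groupType) (psi : 'rV[A]_n -> H), symbol H psi ->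
    exists f : {multiplicative G -> H},
      (forall v, Um v -> f (phi v) = psi v) /\
      (forall g : {multiplicative G -> H},
         (forall v, Um v -> g (phi v) = psi v) -> g =1 f).

(* (G, phi) is MS_{n+1}(A), with its universal Mennicke symbol *)
Definition is_MS (n : nat) (G : groupType) (phi : 'rV[A]_n.+1 -> G) : Prop :=
  universal_symbol (@Mennicke_symbol n) phi.

(* (G, phi) is WMS_{n+1}(A), with its universal weak Mennicke symbol *)
Definition is_WMS (n : nat) (G : groupType) (phi : 'rV[A]_n.+1 -> G) : Prop :=
  universal_symbol (@weak_Mennicke_symbol n) phi.

Definition elem_orbit (n : nat) (v : 'rV[A]_n) : set 'rV[A]_n :=
  [set v *m e | e in @elementary_group n].

(* Um_n(A) / E_n(A) *)
Definition orbit_set (n : nat) : set (set 'rV[A]_n) :=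
  [set elem_orbit v | v in @Um n].

(* star is the group law of Um_{n+1}(A) / E_{n+1}(A) under which this orbit
   set coincides with the group W = WMS_{n+1}(A): the map [v] |-> wms v is a
   bijection onto W carrying star to the multiplication of W. Only the values
   of star on pairs of orbits matter, and they are determined by this. *)
Definition orbit_group_law (n : nat) (W : groupType) (wms : 'rV[A]_n -> W)
    (star : set 'rV[A]_n -> set 'rV[A]_n -> set 'rV[A]_n) : Prop :=
  exists f : set 'rV[A]_n -> W,
    [/\ set_bij (@orbit_set n) [set: W] f,
        forall v, Um v -> f (elem_orbit v) = wms v
      & forall x y, orbit_set x -> orbit_set y ->
        orbit_set (star x y) /\ f (star x y) = (f x * f y)%g].

End UnimodularRows.

(* Main.v *)
Require Import Defs.
From HB Require Import structures.
From mathcomp Require Import all_boot all_order all_algebra.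
From mathcomp Require Import ring_quotient generic_quotient.
From mathcomp Require Import finmap ring zify.
From mathcomp Require Import all_classical all_reals.
From mathcomp Require Import lebesgue_measure complex.

(** Over any commutative ring a weak Mennicke symbol is multiplicative when one
    of the two first entries is a square modulo the tail t
    ([weak_Mennicke_square]). So it is enough to change t, without changing the
    three orbits of (a, t), (b, t) and (a b, t), in such a way that a becomes a
    square modulo t. Adding multiples of a b to the entries of t is allowed.

    Geometrically, these multiples put the common zeros of the entries of t
    into general position away from the zeros of a b
    ([general_position]). There are d entries in dimension d, so the zeros are
    finitely many closed points; and since the real points lie in a closed subset
    of codimension at least 1, none of the zeros is real. By the Nullstellensatz
    ([square_mod_maximal]) the residue fields are all complex, so that a is a
    square at each zero. Being a unit, it is then a square modulo the ideal
    generated by t, by the Chinese remainder theorem and Newton's iteration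
    ([square_mod_ideal]). If there is no real point, the intersection of the real
    maximal ideals is the unit ideal, and both hypotheses of the theorem become
    one.

    For the multiplicativity at squares, the weak relation at c^2 y and
    b = 1 - c^2 y is the product formula for c^2 and b up to the factor y, which
    is a square modulo c^2 b. Such a factor can be absorbed, because multiplying
    two entries of a row by a unit u modulo a third entry acts trivially on
    symbols ([linked_scale23]), although its determinant is u^2.

    Once the universal weak symbol is multiplicative in the first entry, it is a
    Mennicke symbol. Conversely every Mennicke symbol is a weak one, so the two
    universal properties give inverse isomorphisms. *)

Set Implicit Arguments.
Unset Strict Implicit.
Unset Printing Implicit Defensive.

Import Order.TTheory GRing.Theory Num.Theory.

Local Open Scope classical_set_scope.
Local Open Scope quotient_scope.
Local Open Scope ring_scope.

(** * Three entries modulo an ideal *)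

(** The unit ideal is allowed, in contrast to [idealr A]: ideals will be shown
    to be the whole ring. *)
Record is_ideal (A : comNzRingType) (I : set A) : Prop := IsIdeal {
  ideal0 : I 0;
  idealD : forall x y, I x -> I y -> I (x + y);
  idealM : forall a x, I x -> I (a * x) }.

Lemma set_eqr (T : Type) (I : set T) x y : I x -> x = y -> I y.
Proof. by move=> Ix <-. Qed.

Section Triples.
Variables (A : comNzRingType) (J : set A) (G : Type).
Hypothesis J_ideal : is_ideal J.

(** Unimodularity of (x, y, z) over A / J without forming the quotient; J stands
    for the ideal generated by the other entries of a longer row. *)
Definition um3 (x y z : A) : Prop :=
  exists p q s, J (x * p + y * q + z * s - 1).

(** The elementary operations that change one of three entries of a longer row:
    adding an element of J is adding multiples of the other entries. *)
Definition elementary_invariant (F : A -> A -> A -> G) : Prop :=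
  [/\ forall x x' y z p q, um3 x y z -> J (x' - (x + y * p + z * q)) ->
        F x y z = F x' y z,
      forall x y y' z p q, um3 x y z -> J (y' - (y + x * p + z * q)) ->
        F x y z = F x y' z
    & forall x y z z' p q, um3 x y z -> J (z' - (z + x * p + y * q)) ->
        F x y z = F x y z'].

Lemma um3_swap x y z : um3 x y z -> um3 y x z.
Proof. by move=> [p [q [s h]]]; exists q, p, s; apply: (set_eqr h); ring. Qed.

Lemma um3_rot x y z : um3 x y z -> um3 y z x.
Proof. by move=> [p [q [s h]]]; exists q, s, p; apply: (set_eqr h); ring. Qed.

Lemma um3_add x x' y z p q :
  um3 x y z -> J (x' - (x + y * p + z * q)) -> um3 x' y z.
Proof.
move=> [a [b [c h]]] hx; exists a, (b - p * a), (c - q * a).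
by apply: (set_eqr (idealD J_ideal h (idealM J_ideal a hx))); ring.
Qed.

Section Invariance.
Variable F : A -> A -> A -> G.
Hypothesis F_inv : elementary_invariant F.

(** What an elementary path from v to w does to F. Unimodularity of the end
    point is carried along, so that paths compose without side conditions. *)
Definition linked (v w : A * A * A) : Prop :=
  um3 v.1.1 v.1.2 v.2 ->
  um3 w.1.1 w.1.2 w.2 /\ F v.1.1 v.1.2 v.2 = F w.1.1 w.1.2 w.2.

Lemma linked_trans v2 v1 v3 : linked v1 v2 -> linked v2 v3 -> linked v1 v3.
Proof. by move=> h12 h23 /h12[/h23[u3 <-] ->]. Qed.

Lemma linked1 x x' y z p q :
  J (x' - (x + y * p + z * q)) -> linked (x, y, z) (x', y, z).
Proof.
move=> h /= u; split; first exact: um3_add u h.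
by case: F_inv => F1 _ _; apply: F1 u h.
Qed.

Lemma linked2 x y y' z p q :
  J (y' - (y + x * p + z * q)) -> linked (x, y, z) (x, y', z).
Proof.
move=> h /= u; split; last by case: F_inv => _ F2 _; apply: F2 u h.
by apply/um3_swap; apply: um3_add h; apply: um3_swap.
Qed.

Lemma linked3 x y z z' p q :
  J (z' - (z + x * p + y * q)) -> linked (x, y, z) (x, y, z').
Proof.
move=> h /= u; split; last by case: F_inv => _ _ F3; apply: F3 u h.
by apply/um3_rot; apply: um3_add h; do 2!apply: um3_rot.
Qed.

Let J0 := ideal0 J_ideal.

(** Whitehead's lemma: diag(u^-1, u) is a product of elementary matrices over
    A / (x, J), and operations modulo x lift, since multiples of x may be added
    to the other two entries. *)
Lemma linked_move23 x y z u u' k :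
  J (1 - (u * u' + x * k)) -> linked (x, u * y, z) (x, y, u * z).
Proof.
move=> h; set z1 := z + u' * (u * y).
apply: (@linked_trans (x, u * y, z1)).
  by apply: (@linked3 _ _ _ _ 0 u'); apply: (set_eqr J0); rewrite /z1; ring.
apply: (@linked_trans (x, - (u * z), z1)).
  apply: (@linked2 _ _ _ _ (- u * y * k) (- u)).
  by apply: (set_eqr (idealM J_ideal (- u * y) h)); rewrite /z1; ring.
apply: (@linked_trans (x, - (u * z), y)).
  apply: (@linked3 _ _ _ _ ((y - z) * k) u').
  by apply: (set_eqr (idealM J_ideal (y - z) h)); rewrite /z1; ring.
apply: (@linked_trans (x, y - u * z, y)).
  by apply: (@linked2 _ _ _ _ 0 1); apply: (set_eqr J0); ring.
apply: (@linked_trans (x, y - u * z, u * z)).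
  by apply: (@linked3 _ _ _ _ 0 (- 1)); apply: (set_eqr J0); ring.
by apply: (@linked2 _ _ _ _ 0 1); apply: (set_eqr J0); ring.
Qed.

(** A Koszul transvection is a commutator of elementary matrices: adding
    s = y w1 + z w2 to the first entry, then multiples of the first entry to the
    others, then removing s again leaves multiples of s behind, and s = 1 modulo
    x and J. *)
Lemma linked_transvection x y z w0 w1 w2 k :
  J (x * w0 + y * w1 + z * w2 - 1) ->
  linked (x, y, z) (x, y + k * w2, z - k * w1).
Proof.
move=> h; set s := y * w1 + z * w2.
apply: (@linked_trans (x + s, y, z)).
  by apply: (@linked1 _ _ _ _ w1 w2); apply: (set_eqr J0); rewrite /s; ring.
apply: (@linked_trans (x + s, y + k * (x + s) * w2, z)).
  by apply: (@linked2 _ _ _ _ (k * w2) 0); apply: (set_eqr J0); ring.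
apply: (@linked_trans (x + s, y + k * (x + s) * w2, z - k * (x + s) * w1)).
  by apply: (@linked3 _ _ _ _ (- k * w1) 0); apply: (set_eqr J0); ring.
apply: (@linked_trans (x, y + k * (x + s) * w2, z - k * (x + s) * w1)).
  by apply: (@linked1 _ _ _ _ (- w1) (- w2)); apply: (set_eqr J0); rewrite /s; ring.
apply: (@linked_trans (x, y + k * w2, z - k * (x + s) * w1)).
  apply: (@linked2 _ _ _ _ (- k * w2 * (1 - w0)) 0).
  by apply: (set_eqr (idealM J_ideal (- k * w2) h)); rewrite /s; ring.
apply: (@linked3 _ _ _ _ (k * w1 * (1 - w0)) 0).
by apply: (set_eqr (idealM J_ideal (k * w1) h)); rewrite /s; ring.
Qed.

(** The determinant of diag(u, u) is u^2, and yet it acts trivially on (y, z).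
    Let y w1 + z w2 = 1 modulo (x, J); then (y, z) and (- w2, w1) are the rows of
    a matrix M of determinant 1. Adding a multiple of the second row to the first
    one is a transvection of (y, z); adding a multiple of the first row to the
    second one changes nothing but the auxiliary w1 and w2. Hence left
    multiplication of M by a product of elementary matrices is allowed, and
    diag(u, u^-1) is one modulo (x, J). Together with [linked_move23] it follows
    that a single entry may be multiplied by u^2. *)
Lemma linked_scale23 x y z u u' k :
  J (1 - (u * u' + x * k)) -> linked (x, y, z) (x, u * y, u * z).
Proof.
move=> h U; have /= [w0 [w1 [w2 hw]]] := U; move: U.
rewrite -/(linked (x, y, z) (x, u * y, u * z)).
(* (p2, p1), then (y1, z1), then (q2, q1) are the rows produced by Whitehead's
   first three operations on M. The second row (q2, q1) is u (y, z) modulo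
   (x, J), and the last two transvections exchange it with the first row. *)
set p2 := u * y - w2; set p1 := w1 + u * z.
set y1 := y - u' * p2; set z1 := z - u' * p1.
set q2 := p2 + u * y1; set q1 := p1 + u * z1.
apply: (@linked_trans (x, y1, z1)).
  have hp : J (x * w0 + y * p1 + z * (- p2) - 1).
    by apply: (set_eqr hw); rewrite /p1 /p2; ring.
  have := @linked_transvection x y z w0 p1 (- p2) u' hp.
  by rewrite mulrN.
apply: (@linked_trans (x, y1 + q2, z1 + q1)).
  have hq : J (x * w0 + y1 * q1 + z1 * (- q2) - 1).
    by apply: (set_eqr hw); rewrite /q1 /q2 /y1 /z1 /p1 /p2; ring.
  have := @linked_transvection x y1 z1 w0 q1 (- q2) (- 1) hq.
  by rewrite mulrNN !mulN1r opprK !mul1r.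
apply: (@linked_trans (x, q2, q1)).
  have hr : J (x * w0 + (y1 + q2) * (- z1) + (z1 + q1) * y1 - 1).
    by apply: (set_eqr hw); rewrite /q1 /q2 /y1 /z1 /p1 /p2; ring.
  have := @linked_transvection x (y1 + q2) (z1 + q1) w0 (- z1) y1 (- 1) hr.
  by rewrite mulrNN !mulN1r mul1r ![_ + q2]addrC ![_ + q1]addrC !addrK.
apply: (@linked_trans (x, u * y, q1)).
  apply: (@linked2 _ _ _ _ (- k * p2) 0).
  by apply: (set_eqr (idealM J_ideal (- p2) h)); rewrite /q2 /y1; ring.
apply: (@linked3 _ _ _ _ (- k * p1) 0).
by apply: (set_eqr (idealM J_ideal (- p1) h)); rewrite /q1 /z1; ring.
Qed.
End Invariance.

Lemma swap_invariant F :
  elementary_invariant F -> elementary_invariant (fun x y z => F y x z).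
Proof.
move=> [F1 F2 F3]; split=> [x x' y z p q u h|x y y' z p q u h|x y z z' p q u h].
- by apply: F2 h; apply: um3_swap.
- by apply: F1 h; apply: um3_swap.
- by apply: (F3 _ _ _ _ q p); [exact: um3_swap | apply: (set_eqr h); ring].
Qed.

Lemma linked_move13 F x y z u u' k : elementary_invariant F ->
  J (1 - (u * u' + y * k)) -> linked F (u * x, y, z) (x, y, u * z).
Proof.
move=> /swap_invariant F_inv h /um3_swap U.
have [U' e] := linked_move23 F_inv (z := z) (y := x) h U.
by split; first exact: um3_swap.
Qed.

End Triples.

(** * Multiplication by a square *)

Section SquareMul.
Variables (A : comNzRingType) (J : set A) (G : groupType).
Hypothesis J_ideal : is_ideal J.
Variable F : A -> A -> A -> G.
Hypothesis F_inv : elementary_invariant J F.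
Hypothesis F_weak : forall a y z, um3 J a y z -> um3 J (1 - a) y z ->
  (F a y z * F (1 - a) y z)%g = F (a * (1 - a)) y z.
Let J0 := ideal0 J_ideal.

Lemma um3_mul a b y z :
  um3 J a y z -> um3 J b y z -> um3 J (a * b) y z.
Proof.
move=> [p [q [s h]]] [p' [q' [s' h']]].
exists (p * p'), (a * p * q' + q), (a * p * s' + s).
by apply: (set_eqr (idealD J_ideal h (idealM J_ideal (a * p) h'))); ring.
Qed.

(** The weak relation applies to c^2 y and 1 - c^2 y = b, and the factor y is got
    rid of as follows. Modulo c^2 b the entry t1 is changed into some T that is 1
    modulo y. Then y is a unit modulo T, so it moves from the first entry to the
    last. There it can be absorbed, being a square modulo c^2 b: it is 1 modulo
    c^2 and c^-2 modulo b. *)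
Lemma square_mul_special c z t1 t2 :
  let y := 1 + c ^+ 2 * z in let b := 1 - c ^+ 2 * y in
  um3 J (c ^+ 2) t1 t2 -> um3 J b t1 t2 ->
  (F (c ^+ 2) t1 t2 * F b t1 t2)%g = F (c ^+ 2 * b) t1 t2.
Proof.
move=> y b Uc Ub; pose e := c ^+ 2 * b.
pose T := t1 + e * z * (t1 - 1).
pose m := (t1 - 1) * (1 - c ^+ 4 * z).
have TE : T = 1 + y * m by rewrite /T /e /m /b /y; ring.
(* u is 1 modulo c^2 and c modulo b, so u^2 y = 1 modulo e. *)
pose u := 1 + c ^+ 2 * y * (c - 1).
have Ue : um3 J e t1 t2 by apply: um3_mul.
have eT : linked J F (e, t1, t2) (e, T, t2).
  apply: (linked2 J_ideal F_inv (p := z * (t1 - 1)) (q := 0)).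
  by apply: (set_eqr J0); rewrite /T; ring.
have /= [UeT ->] := eT Ue.
have y_unit : J (1 - (y * (- m) + T * 1)).
  by apply: (set_eqr J0); rewrite TE; ring.
have Uy : um3 J y T t2.
  by exists (- m), 1, 0; apply: (set_eqr J0); rewrite TE; ring.
have /(_ Uc) /= [UcT ->] : linked J F (c ^+ 2, t1, t2) (c ^+ 2, T, t2).
  apply: (linked2 J_ideal F_inv (p := b * z * (t1 - 1)) (q := 0)).
  by apply: (set_eqr J0); rewrite /T /e; ring.
have /(_ UcT) /= [_ ->] : linked J F (c ^+ 2, T, t2) (c ^+ 2, T, y * t2).
  apply: (linked3 J_ideal F_inv (p := z * t2) (q := 0)).
  by apply: (set_eqr J0); rewrite /y; ring.
have UyT := um3_mul Uy UcT.
have /(_ UyT) /= [_ <-] := linked_move13 (x := c ^+ 2) (z := t2) J_ideal F_inv y_unit.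
have /(_ Ub) /= [UbT ->] : linked J F (b, t1, t2) (b, T, t2).
  apply: (linked2 J_ideal F_inv (p := c ^+ 2 * z * (t1 - 1)) (q := 0)).
  by apply: (set_eqr J0); rewrite /T /e; ring.
have -> : b = 1 - y * c ^+ 2 by rewrite mulrC.
rewrite F_weak // 1?[y * _]mulrC // -/b.
have -> : c ^+ 2 * y * b = y * e by rewrite /e; ring.
have UyTe := um3_mul Uy UeT.
have /(_ UyTe) /= [UeyT ->] :=
  linked_move13 (x := e) (z := t2) J_ideal F_inv y_unit.
(* The quotient of u^2 y - 1 by e, from its quotients by c^2 and by b and from
   b + c^2 y = 1. *)
pose k := z + y * (2 * y * (c - 1) + c ^+ 2 * y ^+ 2 * (c - 1) ^+ 2)
  + y * (y * (2 * c * (1 - c) + b * (1 - c) ^+ 2) - 1).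
have u_unit : J (1 - (u * (u * y) + e * (- k))).
  by apply: (set_eqr J0); rewrite /k /u /e /b /y; ring.
have /(_ UeyT) /= [UeyT2 ->] :=
  linked_scale23 (y := T) (z := y * t2) J_ideal F_inv u_unit.
have /(_ UeyT2) /= [UeyT3 ->] :=
  linked_move23 (y := T) (z := u * (y * t2)) J_ideal F_inv u_unit.
suff /(_ UeyT3) /= [_ ->] : linked J F (e, T, u * (u * (y * t2))) (e, T, t2) by [].
apply: (linked3 J_ideal F_inv (p := - k * t2) (q := 0)).
by apply: (set_eqr (idealM J_ideal t2 u_unit)); ring.
Qed.

(** Only b modulo (t1, t2, J) matters. As c is a unit there, b can be moved to an
    element of the form 1 - c^2 (1 + c^2 z). *)
Lemma square_mul c b t1 t2 :
  um3 J (c ^+ 2) t1 t2 -> um3 J b t1 t2 ->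
  (F (c ^+ 2) t1 t2 * F b t1 t2)%g = F (c ^+ 2 * b) t1 t2.
Proof.
move=> Uc Ub; have [P [q1 [q2 h]]] := Uc.
pose v := 1 + c ^+ 2 * P; pose w := 1 - c ^+ 2 - b.
pose z := P ^+ 2 * w.
(* As (t1 q1 + t2 q2) v = 1 - c^4 P^2 modulo J, adding w times it to b gives
   1 - c^2 - c^4 z. *)
have hb : J (1 - c ^+ 2 * (1 + c ^+ 2 * z)
    - (b + t1 * (q1 * v * w) + t2 * (q2 * v * w))).
  by apply: (set_eqr (idealM J_ideal (- v * w) h)); rewrite /v /z /w; ring.
have Ucb := um3_mul Uc Ub.
have /(_ Ub) /= [Ub' ->] := linked1 J_ideal F_inv hb.
rewrite square_mul_special //.
suff /(_ Ucb) /= [_ ->] : linked J F (c ^+ 2 * b, t1, t2)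
   (c ^+ 2 * (1 - c ^+ 2 * (1 + c ^+ 2 * z)), t1, t2) by [].
apply: (linked1 J_ideal F_inv (p := c ^+ 2 * (q1 * v * w))
  (q := c ^+ 2 * (q2 * v * w))).
by apply: (set_eqr (idealM J_ideal (c ^+ 2) hb)); ring.
Qed.
End SquareMul.

(** * Rows and symbols *)

Section Rows.
Variable A : comNzRingType.

Definition dot (n : nat) (v w : 'rV[A]_n) : A := \sum_i v 0 i * w 0 i.

Lemma UmP n (v : 'rV[A]_n) : Um v <-> exists w, dot v w = 1.
Proof.
split=> [[w h]|[w h]]; last by exists (w 0).
by exists (\row_i w i); rewrite -h; apply: eq_bigr => i _; rewrite mxE.
Qed.

Lemma dotDl n (v v' w : 'rV[A]_n) : dot (v + v') w = dot v w + dot v' w.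
Proof. by rewrite /dot -big_split; apply: eq_bigr => i _; rewrite mxE mulrDl. Qed.

Lemma dotZl n a (v w : 'rV[A]_n) : dot (a *: v) w = a * dot v w.
Proof. by rewrite /dot big_distrr; apply: eq_bigr => i _; rewrite mxE /= mulrA. Qed.

Lemma dotC n (v w : 'rV[A]_n) : dot v w = dot w v.
Proof. by apply: eq_bigr => i _; rewrite mulrC. Qed.

Lemma dot_delta n (v : 'rV[A]_n) j : dot v (delta_mx 0 j) = v 0 j.
Proof.
rewrite /dot (bigD1 j) //= mxE !eqxx mulr1 big1 ?addr0 // => i ij.
by rewrite mxE (negPf ij) andbF mulr0.
Qed.

Lemma row_cons0 n a (t : 'rV[A]_n) : row_cons a t 0 ord0 = a.
Proof. by rewrite mxE unlift_none. Qed.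

Lemma row_consS n a (t : 'rV[A]_n) i : row_cons a t 0 (lift ord0 i) = t 0 i.
Proof. by rewrite mxE liftK. Qed.

Lemma row_rcons_max n a (t : 'rV[A]_n) : row_rcons t a 0 ord_max = a.
Proof. by rewrite mxE unlift_none. Qed.

Lemma row_rcons_lift n a (t : 'rV[A]_n) i :
  row_rcons t a 0 (lift ord_max i) = t 0 i.
Proof. by rewrite mxE liftK. Qed.

Lemma row_cons_ext n (v w : 'rV[A]_n.+1) : v 0 ord0 = w 0 ord0 ->
  (forall i, v 0 (lift ord0 i) = w 0 (lift ord0 i)) -> v = w.
Proof. by move=> h0 hS; apply/rowP => i; case: (unliftP ord0 i) => [j|] ->. Qed.

Lemma row_consE n (v : 'rV[A]_n.+1) :
  v = row_cons (v 0 ord0) (\row_i v 0 (lift ord0 i)).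
Proof.
by apply: row_cons_ext => [|i]; rewrite ?row_cons0 // row_consS mxE.
Qed.

Lemma row_consP n (v : 'rV[A]_n.+1) : exists a t, v = row_cons a t.
Proof. by do 2!eexists; apply: row_consE. Qed.

Lemma row_rconsE n (v : 'rV[A]_n.+1) :
  v = row_rcons (\row_i v 0 (lift ord_max i)) (v 0 ord_max).
Proof.
apply/rowP => i; case: (unliftP ord_max i) => [j|] ->.
  by rewrite row_rcons_lift mxE.
by rewrite row_rcons_max.
Qed.

Lemma row_rcons_cons n b a (t : 'rV[A]_n) :
  row_rcons (row_cons b t) a = row_cons b (row_rcons t a).
Proof.
apply/rowP => i; case: (unliftP ord_max i) => [j|] ->.
  rewrite row_rcons_lift; case: (unliftP ord0 j) => [k|] ->.
    have -> : lift ord_max (lift ord0 k) = lift ord0 (lift ord_max k).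
      by apply/val_inj; rewrite /= /bump /= !add1n ltnS addnS.
    by rewrite !row_consS row_rcons_lift.
  have -> : lift ord_max ord0 = ord0 :> 'I_n.+2 by apply: val_inj.
  by rewrite !row_cons0.
rewrite row_rcons_max.
have -> : ord_max = lift ord0 ord_max :> 'I_n.+2 by apply: val_inj.
by rewrite row_consS row_rcons_max.
Qed.

Lemma dot_cons n a b (t u : 'rV[A]_n) :
  dot (row_cons a t) (row_cons b u) = a * b + dot t u.
Proof.
rewrite /dot big_ord_recl !row_cons0; congr (_ + _).
by apply: eq_bigr => i _; rewrite !row_consS.
Qed.

Lemma row_cons_add0 n a k (t : 'rV[A]_n) :
  row_cons a t + k *: delta_mx 0 ord0 = row_cons (a + k) t.
Proof.
apply: row_cons_ext => [|i]; rewrite !mxE ?unlift_none ?eqxx ?mulr1 // liftK.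
by rewrite lift_eqF andbF mulr0 addr0.
Qed.

Lemma row_cons_addS n a k (t : 'rV[A]_n) i :
  row_cons a t + k *: delta_mx 0 (lift ord0 i) =
  row_cons a (t + k *: delta_mx 0 i).
Proof.
apply: row_cons_ext => [|j].
  by rewrite !mxE unlift_none eq_liftF andbF mulr0 addr0.
by rewrite !mxE liftK !mxE (inj_eq lift_inj).
Qed.

Lemma Um_cons n a (t : 'rV[A]_n) :
  Um (row_cons a t) <-> exists p u, a * p + dot t u = 1.
Proof.
split=> [/UmP [w]|[p [u h]]].
  by rewrite (row_consE w) dot_cons => h; do 2!eexists; exact: h.
by apply/UmP; exists (row_cons p u); rewrite dot_cons.
Qed.

Lemma Um_mul n (a b : A) (t : 'rV[A]_n) :
  Um (row_cons a t) -> Um (row_cons b t) -> Um (row_cons (a * b) t).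
Proof.
move=> /Um_cons [p [u h]] /Um_cons [p' [u' h']]; apply/Um_cons.
exists (p * p'), ((a * p) *: u' + u).
rewrite dotC dotDl dotZl -!(dotC t).
have -> : dot t u = 1 - a * p by rewrite -h addrC addKr.
have -> : dot t u' = 1 - b * p' by rewrite -h' addrC addKr.
by ring.
Qed.

Lemma elementary_col n (j : 'I_n) (c : 'rV[A]_n) : c 0 j = 0 ->
  elementary_group (1%:M + c^T *m delta_mx 0 j).
Proof.
move=> cj.
suff h s : elementary_group (1%:M + (\sum_(i <- s) c 0 i *: delta_mx i j) : 'M[A]_n).
  have := h (index_enum 'I_n); congr (elementary_group (_ + _)).
  apply/matrixP => k l; rewrite summxE !mxE (bigD1 k) //= big1 => [|i ik].
    by rewrite !mxE !eqxx big_ord1 !mxE /= addr0.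
  by rewrite !mxE eq_sym (negPf ik) mulr0.
elim: s => [|i s IHs]; first by rewrite big_nil addr0; apply: Elem_1.
rewrite big_cons; have [->|ij] := eqVneq i j; first by rewrite cj scale0r add0r.
have := Elem_mul (Elem_gen (c 0 i) ij) IHs.
rewrite mulmxDl mul1mx mulmxDr mulmx1.
suff -> : c 0 i *: delta_mx i j *m (\sum_(k <- s) c 0 k *: delta_mx k j) = 0 :> 'M[A]_n.
  by rewrite addr0 -addrA [X in _ + X]addrC.
rewrite mulmx_sumr big1_seq // => k _; rewrite -scalemxAl -scalemxAr.
have [->|kj] := eqVneq k j; first by rewrite cj scale0r scaler0.
by rewrite mul_delta_mx_0 ?scaler0 // eq_sym.
Qed.

Section Symbol.
Variables (n : nat) (G : Type) (phi : 'rV[A]_n -> G).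
Hypothesis phi_inv : forall v e, Um v -> elementary_group e -> phi v = phi (v *m e).

Lemma symbol_add (v c : 'rV[A]_n) j : c 0 j = 0 -> Um v ->
  Um (v + dot v c *: delta_mx 0 j) /\ phi v = phi (v + dot v c *: delta_mx 0 j).
Proof.
move=> cj Uv; split.
  have /UmP [w h] := Uv; apply/UmP; exists (w - w 0 j *: c).
  have e u : dot u (w - w 0 j *: c) = dot u w - w 0 j * dot u c.
    by rewrite dotC -scaleNr dotDl dotZl mulNr -!(dotC u).
  rewrite dotDl dotZl !e h !(dotC (delta_mx _ _)) !dot_delta cj.
  by ring.
rewrite (phi_inv Uv (elementary_col cj)); congr phi.
rewrite mulmxDr mulmx1 mulmxA; congr (_ + _).
apply/rowP => k; rewrite mxE big_ord1 !mxE; congr (_ * _).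
by apply: eq_bigr => i _; rewrite !mxE.
Qed.

Lemma symbol_eq (v v' c : 'rV[A]_n) j : c 0 j = 0 -> v' = v + dot v c *: delta_mx 0 j ->
  Um v -> Um v' /\ phi v = phi v'.
Proof. by move=> cj ->; apply: symbol_add. Qed.
End Symbol.

Section HeadAndTail.
Variables (n : nat) (G : Type) (phi : 'rV[A]_n.+1 -> G).
Hypothesis phi_inv :
  forall v e, Um v -> elementary_group e -> phi v = phi (v *m e).

Lemma dot0r k (v : 'rV[A]_k) : dot v 0 = 0.
Proof. by rewrite /dot big1 // => i _; rewrite mxE mulr0. Qed.

Lemma symbol_head a t u : Um (row_cons a t) ->
  Um (row_cons (a + dot t u) t) /\
  phi (row_cons a t) = phi (row_cons (a + dot t u) t).
Proof.
apply: (symbol_eq phi_inv (c := row_cons 0 u) (j := ord0)).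
  by rewrite row_cons0.
by rewrite dot_cons mulr0 add0r row_cons_add0.
Qed.

Lemma symbol_tail1 a t k j : Um (row_cons a t) ->
  Um (row_cons a (t + (a * k) *: delta_mx 0 j)) /\
  phi (row_cons a t) = phi (row_cons a (t + (a * k) *: delta_mx 0 j)).
Proof.
apply: (symbol_eq phi_inv (c := row_cons k 0) (j := lift ord0 j)).
  by rewrite row_consS mxE.
by rewrite dot_cons dot0r addr0 row_cons_addS.
Qed.

Lemma symbol_tail a t u : Um (row_cons a t) ->
  Um (row_cons a (t + a *: u)) /\ phi (row_cons a t) = phi (row_cons a (t + a *: u)).
Proof.
move=> Ut; rewrite [u]row_sum_delta scaler_sumr.
suff h s : Um (row_cons a (t + \sum_(i <- s) a *: (u 0 i *: delta_mx 0 i))) /\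
    phi (row_cons a t)
    = phi (row_cons a (t + \sum_(i <- s) a *: (u 0 i *: delta_mx 0 i))).
  exact: h.
elim: s => [|i s [Us ->]]; first by rewrite big_nil addr0.
rewrite big_cons scalerA [_ *: _ + _]addrC addrA.
exact: symbol_tail1.
Qed.
End HeadAndTail.

(** Three additions exchange two entries up to a sign. *)
Lemma symbol_swap n (G : Type) (phi : 'rV[A]_n.+2 -> G) :
  (forall v e, Um v -> elementary_group e -> phi v = phi (v *m e)) ->
  forall a b t, Um (row_cons a (row_rcons t b)) ->
  Um (row_cons b (row_rcons t (- a))) /\
  phi (row_cons a (row_rcons t b)) = phi (row_cons b (row_rcons t (- a))).
Proof.
move=> phi_inv a b t U.
have rcons_max c d : row_rcons t c + d *: delta_mx 0 ord_max = row_rcons t (c + d).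
  apply/rowP => i; rewrite !mxE; case: unliftP => [j|] ->.
    by rewrite lift_eqF andbF mulr0 addr0.
  by rewrite !eqxx mulr1.
have [U1 ->] := symbol_head phi_inv (delta_mx 0 ord_max) U.
rewrite dot_delta row_rcons_max in U1 *.
have [U2 ->] := symbol_tail1 phi_inv (- 1) ord_max U1.
rewrite rcons_max in U2 *.
have [U3 ->] := symbol_head phi_inv (delta_mx 0 ord_max) U2.
rewrite dot_delta row_rcons_max in U3 *.
have e1 : b + (a + b) * -1 = - a by ring.
by move: U3; rewrite e1 [a + b]addrC addrK.
Qed.

Definition row3 (m : nat) (r : 'rV[A]_m) x y z : 'rV[A]_m.+3 :=
  row_cons x (row_cons y (row_cons z r)).

Definition entry_ideal m (r : 'rV[A]_m) : set A := [set x | exists u, dot r u = x].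

Lemma entry_ideal_is_ideal m (r : 'rV[A]_m) : is_ideal (entry_ideal r).
Proof.
split=> [|x y [u <-] [v <-]|a x [u <-]].
- by exists 0; apply: dot0r.
- by exists (u + v); rewrite !(dotC r) dotDl.
- by exists (a *: u); rewrite !(dotC r) dotZl.
Qed.

Lemma um3P m (r : 'rV[A]_m) x y z :
  um3 (entry_ideal r) x y z <-> Um (row3 r x y z).
Proof.
split=> [[p [q [s [u h]]]]|/UmP [w]].
  apply/UmP; exists (row3 (- u) p q s).
  by rewrite !dot_cons dotC -scaleN1r dotZl dotC h; ring.
have [p [w1 ->]] := row_consP w; have [q [w2 ->]] := row_consP w1.
have [k [u ->]] := row_consP w2; rewrite !dot_cons => h.
exists p, q, k, (- u); rewrite -h dotC -scaleN1r dotZl dotC; ring.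
Qed.

Section WeakMennicke.
Variables (m : nat) (G : groupType) (phi : 'rV[A]_m.+3 -> G).
Hypothesis phi_weak : weak_Mennicke_symbol phi.

Lemma weak_symbol_inv r :
  elementary_invariant (entry_ideal r) (fun x y z => phi (row3 r x y z)).
Proof.
case: phi_weak => _ phi_inv _.
split=> [x x' y z p q|x y y' z p q|x y z z' p q] /um3P U [u hu].
- have [_ ->] := symbol_head phi_inv (row_cons p (row_cons q u)) U.
  by rewrite !dot_cons hu; congr (phi (row_cons _ _)); ring.
- suff E : row3 r x y' z =
      row3 r x y z + dot (row3 r x y z) (row3 u p 0 q) *: delta_mx 0 (lift ord0 ord0).
    have [//|_ ->] := symbol_add phi_inv (c := row3 u p 0 q) (j := lift ord0 ord0) _ U.
      by rewrite row_consS row_cons0.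
    by rewrite E.
  rewrite row_cons_addS row_cons_add0 !dot_cons hu.
  by congr (row_cons _ (row_cons _ _)); ring.
suff E : row3 r x y z' = row3 r x y z + dot (row3 r x y z) (row3 u p q 0) *:
    delta_mx 0 (lift ord0 (lift ord0 ord0)).
  have [//|_ ->] := symbol_add phi_inv (c := row3 u p q 0)
    (j := lift ord0 (lift ord0 ord0)) _ U; last by rewrite E.
  by rewrite !row_consS row_cons0.
rewrite !row_cons_addS row_cons_add0 !dot_cons hu.
by congr (row_cons _ (row_cons _ (row_cons _ _))); ring.
Qed.

(** A weak Mennicke symbol is multiplicative as soon as one factor is a square,
    over any ring: [square_mul] for the first three entries, modulo the ideal of
    the others. *)
Lemma weak_Mennicke_square c b t :
  Um (row_cons (c ^+ 2) t) -> Um (row_cons b t) ->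
  (phi (row_cons (c ^+ 2) t) * phi (row_cons b t))%g
  = phi (row_cons (c ^+ 2 * b) t).
Proof.
have [y [t' ->]] := row_consP t; have [z [r ->]] := row_consP t'.
move=> /um3P U2 /um3P Ub.
apply: (square_mul (entry_ideal_is_ideal r) (weak_symbol_inv r)) => // a y' z'.
by move=> /um3P Ua /um3P Ua'; case: phi_weak => _ _; apply.
Qed.
End WeakMennicke.
End Rows.

(** * Noetherian rings *)

Definition generated (A : comNzRingType) (f : nat -> A) (n : nat) : set A :=
  [set x | exists u : nat -> A, x = \sum_(i < n) u i * f i].

(** Equivalent to the ascending chain condition. In this form it is easily both
    proved for polynomials and used to refute an infinite chain of ideals. *)
Definition noetherian (A : comNzRingType) : Prop :=
  forall f : nat -> A, exists n, generated f n (f n).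

(** Dependent choice with access to all the previous terms; Q may only look at
    the terms of f before n. *)
Lemma history_choice (T : Type) (x0 : T) (Q : (nat -> T) -> nat -> T -> Prop) :
  (forall f g n x, (forall i, (i < n)%N -> f i = g i) -> Q f n x -> Q g n x) ->
  (forall f n, exists x, Q f n x) -> exists f, forall n, Q f n (f n).
Proof.
move=> Qext Qex; pose next f n := sval (cid (Qex f n)).
pose past := fix past n : seq T := if n is n'.+1
  then rcons (past n') (next (nth x0 (past n')) n') else [::].
pose f n := next (nth x0 (past n)) n.
have size_past n : size (past n) = n.
  by elim: n => //= n IHn; rewrite size_rcons IHn.
have nth_past n i : (i < n)%N -> nth x0 (past n) i = f i.
  elim: n => // n IHn; rewrite ltnS leq_eqVlt /= nth_rcons size_past.
  by case: ltngtP => // [lt_in _|-> //]; apply: IHn.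
exists f => n; apply: (Qext (nth x0 (past n))) => [i|]; first exact: nth_past.
by rewrite /f /next; case: cid.
Qed.

Section Generated.
Variable A : comNzRingType.
Implicit Types (f g : nat -> A) (I : set A).

Lemma generated_ideal f n : is_ideal (generated f n).
Proof.
split=> [|x y [u ->] [v ->]|a x [u ->]].
- by exists (fun=> 0); rewrite big1 // => i _; rewrite mul0r.
- exists (fun i => u i + v i); rewrite -big_split.
  by apply: eq_bigr => i _; rewrite mulrDl.
- exists (fun i => a * u i); rewrite big_distrr.
  by apply: eq_bigr => i _; rewrite /= mulrA.
Qed.

Lemma generated_mem f n i : (i < n)%N -> generated f n (f i).
Proof.
move=> lt_in; exists (fun j => (j == i)%:R).
rewrite (bigD1 (Ordinal lt_in)) //= eqxx mul1r big1 ?addr0 // => j.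
by rewrite -val_eqE /= => /negPf ->; rewrite mul0r.
Qed.

Lemma generated_sub f n I : is_ideal I ->
  (forall i, (i < n)%N -> I (f i)) -> generated f n `<=` I.
Proof.
move=> [I0 ID IM] h x [u ->]; apply: (big_ind I) => // i _.
exact/IM/h/ltn_ord.
Qed.

Lemma eq_generated f g n : (forall i, (i < n)%N -> f i = g i) ->
  generated f n = generated g n.
Proof.
move=> fg; apply/seteqP; split; apply: generated_sub;
  try exact: generated_ideal.
- by move=> i lt_in; rewrite fg //; apply: generated_mem.
- by move=> i lt_in; rewrite -fg //; apply: generated_mem.
Qed.
End Generated.

(** Suppose that no f n is in the ideal of the previous ones, and let I be the
    ideal of all of them. Choose g n of least degree in I outside the ideal of
    g 0, ..., g (n - 1). Some leading coefficient of the g n is a combination of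
    the previous ones, and cancelling it produces a polynomial of smaller degree
    outside the same ideal. *)
Lemma hilbert_basis (B : comNzRingType) : noetherian B -> noetherian {poly B}.
Proof.
move=> noethB f; apply: contrapT => /forallNP f_new.
pose I : set {poly B} := [set p | exists n, generated f n p].
have mono n m p : (n <= m)%N -> generated f n p -> generated f m p.
  move=> le_nm; apply: generated_sub; first exact: generated_ideal.
  by move=> i lt_in; apply/generated_mem/(leq_trans lt_in).
have I_ideal : is_ideal I.
  split=> [|x y [n hx] [m hy]|a x [n hx]].
  - by exists 0%N; apply: ideal0 (generated_ideal _ _).
  - exists (n + m)%N; apply: idealD; first exact: generated_ideal.
      by apply: mono hx; apply: leq_addr.
    by apply: mono hy; apply: leq_addl.
  - by exists n; apply: idealM hx; apply: generated_ideal.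
(* The g i lie in the ideal of some f 0, ..., f (N - 1), which misses f N. *)
have I_escape g n : (forall i, (i < n)%N -> I (g i)) ->
    exists p, I p /\ ~ generated g n p.
  move=> Ig; have [N hN] : exists N, forall i, (i < n)%N -> generated f N (g i).
    elim: n Ig => [|n IHn] Ig; first by exists 0%N.
    have [N hN] := IHn (fun i h => Ig i (ltnW h)).
    have [M hM] := Ig n (ltnSn n); exists (N + M)%N => i.
    rewrite ltnS leq_eqVlt => /orP[/eqP ->|/hN]; last first.
      by apply: mono; apply: leq_addr.
    by apply: mono hM; apply: leq_addl.
  exists (f N); split; first by exists N.+1; apply: generated_mem.
  by move=> /(generated_sub (generated_ideal f N) hN); apply: f_new.
pose Q g n (p : {poly B}) := (forall i, (i < n)%N -> I (g i)) ->
  [/\ I p, ~ generated g n p &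
      forall q, I q -> ~ generated g n q -> (size p <= size q)%N].
have [g gP] : exists g, forall n, Q g n (g n).
  apply: (history_choice 0) => [g g' n p gg' hQ Ig'|g n].
    rewrite -(eq_generated gg'); apply: hQ => i lt_in.
    by rewrite gg' //; apply: Ig'.
  have [Ig|] := pselect (forall i, (i < n)%N -> I (g i)); last by exists 0.
  have ex_size : exists k,
      `[< exists p, [/\ I p, ~ generated g n p & size p = k] >].
    by have [p [Ip gp]] := I_escape g n Ig; exists (size p); apply/asboolP; exists p.
  case: (ex_minnP ex_size) => k /asboolP [p [Ip gp <-]] kmin.
  exists p => _; split=> // q Iq gq; apply: kmin.
  by apply/asboolP; exists q.
have Ig n : I (g n).
  by elim/ltn_ind: n => n IHn; case: (gP n IHn).
have g_new n : ~ generated g n (g n) by case: (gP n (fun i _ => Ig i)).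
have g_min n q : I q -> ~ generated g n q -> (size (g n) <= size q)%N.
  by case: (gP n (fun i _ => Ig i)) => _ _; apply.
have [n [u hu]] := noethB (fun i => lead_coef (g i)).
have le_size i : (i < n)%N -> (size (g i) <= size (g n))%N.
  move=> lt_in; apply: g_min => //; apply: contra_not (g_new n).
  apply: generated_sub; first exact: generated_ideal.
  by move=> j lt_ji; apply/generated_mem/(ltn_trans lt_ji).
(* h has the leading term of g n. *)
pose h := \sum_(i < n) (u i *: 'X^(size (g n) - size (g i))) * g i.
have hgen : generated g n h by exists (fun i => u i *: 'X^(size (g n) - size (g i))).
have g0 i : (0 < size (g i))%N.
  rewrite lt0n size_poly_eq0; apply/eqP => gi0.
  by apply: (g_new i); rewrite gi0; apply: ideal0 (generated_ideal _ _).
have : (size (g n) <= size (g n - h)%R)%N.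
  apply: g_min.
    apply: idealD => //; rewrite -mulN1r; apply: idealM => //.
    by apply: (generated_sub I_ideal _ hgen).
  move=> gh; apply: (g_new n); rewrite -[g n](subrK h).
  by apply: idealD gh hgen; apply: generated_ideal.
apply/negP; rewrite -ltnNge -(ltn_predK (g0 n)) ltnS.
apply/leq_sizeP => j; rewrite coefB /h coef_sum => le_j.
have coef_term (i : 'I_n) : (u i *: 'X^(size (g n) - size (g i)) * g i)`_j =
    u i * (g i)`_(j - (size (g n) - size (g i))).
  rewrite -scalerAl coefZ coefXnM; case: ltnP => // lt_j; exfalso.
  have := le_size i (ltn_ord i); have := g0 i; have := g0 n.
  move: le_j lt_j; lia.
rewrite (eq_bigr _ (fun i _ => coef_term i)).
move: le_j; rewrite leq_eqVlt => /orP[/eqP <-|lt_j].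
  rewrite -/(lead_coef (g n)) hu -sumrB big1 // => i _.
  rewrite (_ : _.-1 - _ = (size (g i)).-1)%N ?subrr //.
  have := le_size i (ltn_ord i); have := g0 i; have := g0 n; lia.
rewrite nth_default ?sub0r; last by move: lt_j; case: (size _) (g0 n).
rewrite big1 ?oppr0 // => i _; rewrite nth_default ?mulr0 //.
have := le_size i (ltn_ord i); have := g0 n; move: lt_j.
by case: (size (g n)) => // a; move: (size (g i)) => b /=; lia.
Qed.

Lemma noetherian_surj (B A : comNzRingType) (g : {rmorphism B -> A}) :
  (forall x, exists y, g y = x) -> noetherian B -> noetherian A.
Proof.
move=> g_surj noethB f; have [h hP] := choice (fun n => g_surj (f n)).
have [n [u hu]] := noethB h; exists n, (g \o u).
by rewrite -hP hu rmorph_sum; apply: eq_bigr => i _; rewrite rmorphM /= hP.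
Qed.

Lemma noetherian_field (K : fieldType) : noetherian K.
Proof.
move=> f; have [f0|f0] := eqVneq (f 0%N) 0.
  by exists 0%N, (fun=> 0); rewrite big_ord0.
by exists 1%N, (fun=> f 1%N / f 0%N); rewrite big_ord1 divfK.
Qed.

(** A is the image of an iterated polynomial ring over R, with one variable for
    each generator. *)
Lemma noetherian_fg_algebra (R : realType) (A : comAlgType R) :
  finitely_generated_algebra A -> noetherian A.
Proof.
move=> [s hs].
suff [B [g [noethB gR gs]]] : exists (B : comNzRingType) (g : {rmorphism B -> A}),
    [/\ noetherian B, forall c : R, exists y, g y = c%:A
      & forall x, x \in s -> exists y, g y = x].
  apply: (@noetherian_surj B A g) => // x.
  pose S : {pred A} := fun x => `[< exists y, g y = x >].
  suff /asboolP : x \in S by [].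
  apply: hs => [|y /gs]; last by move=> ?; apply/asboolP.
  split=> [|a y z /asboolP [y' <-] /asboolP [z' <-]
            |y z /asboolP [y' <-] /asboolP [z' <-]].
  - by apply/asboolP; exists 1; apply: rmorph1.
  - have [a' ha] := gR a; apply/asboolP; exists (a' * y' + z').
    by rewrite rmorphD rmorphM /= ha -scalerAl mul1r.
  - by apply/asboolP; exists (y' * z'); apply: rmorphM.
elim: s {hs} => [|x s [B [g [noethB gR gs]]]].
  by exists R, (in_alg A); split=> // [|c]; [apply: noetherian_field | exists c].
pose h := horner_morph (fun y => mulrC x (g y)).
have hC c : h c%:P = g c by apply: horner_morphC.
exists {poly B}, h; split=> [|c|y]; first exact: hilbert_basis.
  by have [y <-] := gR c; exists y%:P.
rewrite inE => /predU1P [->|/gs [z <-]]; last by exists z%:P.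
by exists 'X; apply: horner_morphX.
Qed.

(** * Prime ideals of a noetherian ring *)

Section PrimeIdeals.
Variable A : comNzRingType.
Implicit Types (I P : set A).

Record is_prime P : Prop := IsPrime {
  prime_ideal : is_ideal P;
  prime1 : ~ P 1;
  primeM : forall x y, P (x * y) -> P x \/ P y }.

Definition adjoin I (x : A) : set A := [set z | exists y a, I y /\ z = y + a * x].

Lemma adjoin_ideal I x : is_ideal I -> is_ideal (adjoin I x).
Proof.
move=> I_ideal; split=> [|_ _ [y [a [Iy ->]]] [z [b [Iz ->]]]|b _ [y [a [Iy ->]]]].
- by exists 0, 0; split; [apply: ideal0 | ring].
- by exists (y + z), (a + b); split; [apply: idealD | ring].
- by exists (b * y), (b * a); split; [apply: idealM | ring].
Qed.

Lemma adjoin_sub I x : I `<=` adjoin I x.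
Proof. by move=> y Iy; exists y, 0; rewrite mul0r addr0. Qed.

Lemma adjoin_mem I x : is_ideal I -> adjoin I x x.
Proof.
by move=> I_ideal; exists 0, 1; rewrite mul1r add0r; split=> //; apply: ideal0.
Qed.

Lemma prime_prod (T : eqType) P (s : seq T) (f : T -> A) : is_prime P ->
  P (\prod_(i <- s) f i) -> exists2 i, i \in s & P (f i).
Proof.
move=> P_prime; elim: s => [|j s IHs]; first by rewrite big_nil => /(prime1 P_prime).
rewrite big_cons => /(primeM P_prime) [Pj|/IHs [i si Pi]].
  by exists j; rewrite ?mem_head.
by exists i; rewrite // in_cons si orbT.
Qed.

Lemma primeX P x n : is_prime P -> P (x ^+ n) -> P x.
Proof.
move=> P_prime; elim: n => [|n IHn]; first by rewrite expr0 => /(prime1 P_prime).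
by rewrite exprS => /(primeM P_prime) [].
Qed.

Section Noetherian.
Hypothesis noethA : noetherian A.

(** A counterexample starts an infinite strictly increasing chain of ideals;
    elements picked in the successive differences contradict noetherianity. *)
Lemma noetherian_ind (Q : set A -> Prop) :
  (forall I, is_ideal I ->
     (forall J, is_ideal J -> I `<=` J -> ~ (J `<=` I) -> Q J) -> Q I) ->
  forall I, is_ideal I -> Q I.
Proof.
move=> Qind I0 I0_ideal; apply: contrapT => nQ0.
pose bad := {I : set A | is_ideal I /\ ~ Q I}.
have step (I : bad) : exists J : bad * A,
    [/\ sval I `<=` sval J.1, sval J.1 J.2 & ~ sval I J.2].
  case: I => I [I_ideal nQI] /=; apply: contrapT => noJ; apply: nQI.
  apply: Qind => // J J_ideal IJ /existsNP [x /not_implyP [Jx nIx]].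
  by apply: contrapT => nQJ; apply: noJ; exists (exist _ J (conj J_ideal nQJ), x).
have [next nextP] := choice step.
pose chain n := iter n (fst \o next) (exist _ I0 (conj I0_ideal nQ0)).
pose f n := (next (chain n)).2.
have chain_mono n m : (n <= m)%N -> sval (chain n) `<=` sval (chain m).
  move=> /subnK <-; elim: (m - n)%N => [|k IHk] //.
  by apply: subset_trans IHk _; case: (nextP (chain (k + n)%N)).
have [n gen_fn] := noethA f; case: (nextP (chain n)) => _ _; apply.
apply: (generated_sub _ _ gen_fn) => [|i lt_in]; first by case: (svalP (chain n)).
by apply: (chain_mono i.+1 n lt_in); case: (nextP (chain i)).
Qed.

(** By noetherian induction: when x y is in I and neither x nor y is, multiply
    the factors of I + (x) by those of I + (y). All that is needed about minimal
    primes and radicals is read off these finitely many factors. *)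
Lemma prime_factors I : is_ideal I -> exists n (P : nat -> set A),
  (forall i, (i < n)%N -> is_prime (P i) /\ I `<=` P i) /\
  (forall x, (forall i, (i < n)%N -> P i (x i)) -> I (\prod_(i < n) x i)).
Proof.
elim/noetherian_ind => {}I I_ideal IH.
have [I1|nI1] := pselect (I 1).
  by exists 0%N, (fun=> I); split=> // x _; rewrite big_ord0.
have [I_prime|] := pselect (forall x y, I (x * y) -> I x \/ I y).
  exists 1%N, (fun=> I); split=> [i _|x hx]; first by split.
  by rewrite big_ord1; apply: hx.
move=> /existsNP [x /existsNP [y /not_implyP [Ixy /not_orP [nIx nIy]]]].
have IHadj z : ~ I z -> exists n (P : nat -> set A),
    (forall i, (i < n)%N -> is_prime (P i) /\ adjoin I z `<=` P i) /\
    (forall x, (forall i, (i < n)%N -> P i (x i)) -> adjoin I z (\prod_(i < n) x i)).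
  move=> nIz; apply: IH; [exact: adjoin_ideal | exact: adjoin_sub |].
  by move=> /(_ z (adjoin_mem z I_ideal)).
have [n [P [hP prodP]]] := IHadj _ nIx; have [m [Q [hQ prodQ]]] := IHadj _ nIy.
exists (n + m)%N, (fun i => if (i < n)%N then P i else Q (i - n)%N).
split=> [i lt_i|z hz].
  case: ltnP => [/hP [? PI]|le_ni]; first by split=> // w /(@adjoin_sub I x)/PI.
  by have [|? QI] := hQ (i - n)%N; [lia | split=> // w /(@adjoin_sub I y)/QI].
rewrite big_split_ord /=.
have [i lt_in|a [b [Ia ->]]] := prodP z.
  by have := hz i; rewrite lt_in; apply; lia.
have [i lt_im|c [e [Ic ->]]] := prodQ (fun i => z (n + i)%N).
  have E : (n + i < n)%N = false by lia.
  by have := hz (n + i)%N; rewrite E addKn; apply; lia.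
have -> : (a + b * x) * (c + e * y) =
    (c + e * y) * a + (b * x * c + b * e * (x * y)) by ring.
by do 2?[apply: idealD => //]; apply: idealM.
Qed.

Lemma proper_ideal_in_prime I :
  is_ideal I -> ~ I 1 -> exists2 P, is_prime P & I `<=` P.
Proof.
move=> /prime_factors [[|n] [P [hP prodP]]] nI1.
  by case: nI1; have := prodP (fun=> 0); rewrite big_ord0; apply.
by have [? ?] := hP 0%N isT; exists (P 0%N).
Qed.

Lemma noetherian_nilpotent I x : is_ideal I ->
  (forall P, is_prime P -> I `<=` P -> P x) -> exists n, I (x ^+ n).
Proof.
move=> /prime_factors [n [P [hP prodP]]] hx; exists n.
have := prodP (fun=> x); rewrite prodr_const card_ord; apply=> i lt_in.
by case: (hP i lt_in); apply: hx.
Qed.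

(** The family contains the minimal primes over I: if Q contained none of its
    members, a product of elements of the P i outside Q would be in I. *)
Lemma finitely_many_minimal_primes I : is_ideal I -> exists n (P : nat -> set A),
  (forall i, (i < n)%N -> is_prime (P i) /\ I `<=` P i) /\
  (forall Q, is_prime Q -> I `<=` Q -> exists2 i, (i < n)%N & P i `<=` Q).
Proof.
move=> /prime_factors [n [P [hP prodP]]]; exists n, P; split=> // Q Q_prime IQ.
apply: contrapT => noP.
have h i : exists x, (i < n)%N -> P i x /\ ~ Q x.
  case: (ltnP i n) => [lt_in|]; last by exists 0.
  apply: contrapT => /forallNP no_x; apply: noP; exists i => // x Px.
  by apply: contrapT => nQx; apply: (no_x x).
have [x hx] := choice h.
have IPx : I (\prod_(i < n) x i).
  by apply: prodP => i lt_in; case: (hx i lt_in).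
have [i _ Qx] := prime_prod Q_prime (IQ _ IPx).
by case: (hx i (ltn_ord i)) => _; apply.
Qed.
End Noetherian.
End PrimeIdeals.

(** * Residue fields of a real affine algebra *)

Lemma uncountable_reals (R : realType) : ~ countable [set: R].
Proof.
move=> /countable_lebesgue_measure0.
by rewrite -set_itvNyy lebesgue_measure_itv.
Qed.

(** R is uncountable, so one of countably many classes is infinite. *)
Lemma real_pigeonhole (R : realType) (N : R -> nat) (k : nat -> nat) :
  exists n (s : seq R), [/\ uniq s, size s = k n & forall x, x \in s -> N x = n].
Proof.
have [n Ninf] : exists n, infinite_set [set x | N x = n].
  apply: contrapT => /forallNP Nfin; apply: (@uncountable_reals R).
  have -> : [set: R] = \bigcup_(n in [set: nat]) [set x | N x = n].
    by apply/seteqP; split=> // x _; exists (N x).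
  apply: bigcup_countable => // n _.
  by apply: finite_set_countable; apply: contrapT (Nfin n).
have [B BN kB] := infinite_set_fset (k n) Ninf.
exists n, (take (k n) (enum_fset B)); split.
- by rewrite take_uniq // fset_uniq.
- by rewrite size_takel.
- by move=> x /mem_take xB; apply: BN.
Qed.

Section Algebra.
Variables (R : realType) (A : comAlgType R).

Definition spanned (l : seq A) : set A :=
  [set x | exists c : nat -> R, x = \sum_(i < size l) c i *: l`_i].

Lemma spanned_ind (l : seq A) (S : set A) : S 0 ->
  (forall a x y, S x -> S y -> S (a *: x + y)) ->
  (forall x, x \in l -> S x) -> spanned l `<=` S.
Proof.
move=> S0 SD Sl x [c ->]; apply: (big_rec S) => // i y _ Sy.
by apply: SD => //; apply/Sl/mem_nth.
Qed.

Lemma spanned0 l : spanned l 0.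
Proof. by exists (fun=> 0); rewrite big1 // => i _; rewrite scale0r. Qed.

Lemma spanned_lin l a x y : spanned l x -> spanned l y -> spanned l (a *: x + y).
Proof.
move=> [c ->] [e ->]; exists (fun i => a * c i + e i).
by rewrite scaler_sumr -big_split; apply: eq_bigr => i _; rewrite /= scalerA scalerDl.
Qed.

Lemma spanned_mem l x : x \in l -> spanned l x.
Proof.
move=> xl; have lt := xl; rewrite -index_mem in lt.
exists (fun i => (i == index x l)%:R).
rewrite (bigD1 (Ordinal lt)) //= eqxx scale1r nth_index // big1 ?addr0 // => i.
by rewrite -val_eqE /= => /negPf ->; rewrite scale0r.
Qed.

Lemma spanned_sub l l' : {subset l <= l'} -> spanned l `<=` spanned l'.
Proof.
move=> ll'; apply: spanned_ind; [exact: spanned0 | move=> a x y; exact: spanned_lin |].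
by move=> x /ll'; apply: spanned_mem.
Qed.

(** L n consists of the monomials of degree at most n in the generators. *)
Lemma countable_dimension : finitely_generated_algebra A ->
  exists L : nat -> seq A, forall x, exists n, spanned (L n) x.
Proof.
move=> [s hs].
pose L := fix L n := if n is n'.+1 then L n' ++ allpairs *%R s (L n') else [:: 1].
exists L => x.
have L_mono n m : {subset L m <= L (n + m)%N}.
  elim: n => // n IHn y /IHn; rewrite addSn /= mem_cat => ->; exact: orTb.
have L_mul n m y z : y \in L n -> z \in L m -> y * z \in L (n + m)%N.
  elim: n y => [|n IHn] y /=; first by rewrite inE => /eqP ->; rewrite mul1r.
  rewrite mem_cat => /orP [/IHn h /h|/allpairsP [[a b] /= [sa Lb ->]] Lz].
    by rewrite mem_cat => ->.
  rewrite mem_cat -mulrA; apply/orP; right.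
  by apply: allpairs_f => //; apply: IHn.
pose S : {pred A} := fun x => `[< exists n, spanned (L n) x >].
suff /asboolP : x \in S by [].
apply: hs => [|y sy]; last first.
  apply/asboolP; exists 1%N; apply: spanned_mem.
  have : y * 1 \in [:: 1] ++ allpairs *%R s [:: 1].
    by rewrite mem_cat allpairs_f ?orbT // mem_head.
  by rewrite mulr1.
have up n m : spanned (L m) `<=` spanned (L (n + m)%N).
  exact/spanned_sub/L_mono.
split=> [|a y z /asboolP [n hy] /asboolP [m hz]|y z /asboolP [n hy] /asboolP [m hz]].
- by apply/asboolP; exists 0%N; apply: spanned_mem; rewrite inE.
- apply/asboolP; exists (n + m)%N; apply: spanned_lin; last exact: up.
  by rewrite addnC; apply: up.
- apply/asboolP; exists (n + m)%N; move: y hy.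
  apply: spanned_ind => [|a y y' hy hy'|y yL]; first by rewrite mul0r; exact: spanned0.
    by rewrite mulrDl -scalerAl; apply: spanned_lin.
  move: z hz; apply: spanned_ind => [|a z z' hz hz'|z zL].
  - by rewrite mulr0; exact: spanned0.
  - by rewrite mulrDr -scalerAr; apply: spanned_lin.
  - by apply: spanned_mem; apply: L_mul.
Qed.

Lemma scalarM (a b : R) : (a * b)%:A = a%:A * b%:A :> A.
Proof. by rewrite -scalerAl mul1r scalerA. Qed.

Section Maximal.
Variable M : set A.
Hypothesis M_prime : is_prime M.
Hypothesis M_max : forall x, ~ M x -> exists y, M (y * x - 1).
Hypothesis A_fg : finitely_generated_algebra A.
Let M_ideal := prime_ideal M_prime.

(** Suppose that x - a is invertible modulo M for every real a, with inverse y a.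
    These are uncountably many elements of a space of countable dimension, so
    some of them satisfy a linear relation. Clearing the denominators of
    sum_j v_j / (x - s_j) = 0 yields q, and q is not zero because
    q(s_j) = v_j prod_(i != j) (s_j - s_i). *)
Lemma algebraic_mod_maximal x :
  exists2 q : {poly R}, q != 0 & M (horner_alg x q).
Proof.
have [[a Ma]|/forallNP no_root] := pselect (exists a, M (x - a%:A)).
  exists ('X - a%:P); first by rewrite polyXsubC_eq0.
  by rewrite rmorphB /= horner_algX horner_algC.
have [y hy] := choice (fun a => M_max (no_root a)).
have [L hL] := countable_dimension A_fg.
have [N hN] := choice (fun a => hL (y a)).
have [n [s [s_uniq sz sN]]] := real_pigeonhole N (fun n => (size (L n)).+1).
have coords a : exists c : nat -> R, a \in s ->
    y a = \sum_(i < size (L n)) c i *: (L n)`_i.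
  have [sa|nsa] := boolP (a \in s); last by exists (fun=> 0).
  by have [c] := hN a; rewrite (sN a sa) => h; exists c.
have [c hc] := choice coords.
pose k := size (L n).
have s_in (j : 'I_k.+1) : s`_j \in s by rewrite mem_nth // sz.
pose C : 'M[R]_(k.+1, k) := \matrix_(j, i) c s`_j i.
pose v := nz_row (kermx C).
have vC : v *m C = 0 by apply/sub_kermxP; apply: nz_row_sub.
have [j1 hj1] : exists j, v 0 j != 0.
  by apply/rV0Pn; rewrite nz_row_eq0 kermx_eq0 /row_free neq_ltn ltnS rank_leq_col.
have vy : \sum_(j < k.+1) v 0 j *: y s`_j = 0.
  rewrite (eq_bigr (fun j => \sum_(i < k) (v 0 j * C j i) *: (L n)`_i)) => [|j _].
    rewrite exchange_big big1 // => i _; rewrite -scaler_suml /=.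
    have := congr1 (fun w : 'rV_k => w 0 i) vC; rewrite !mxE => ->.
    by rewrite scale0r.
  rewrite hc // scaler_sumr; apply: eq_bigr => i _.
  by rewrite scalerA mxE.
pose q := \sum_(j < k.+1) v 0 j *: \prod_(i < k.+1 | i != j) ('X - (s`_i)%:P).
exists q.
  apply: contraNneq hj1 => q0.
  have : q.[s`_j1] = 0 by rewrite q0 horner0.
  rewrite /q horner_sum (bigD1 j1) //= [X in _ + X]big1 ?addr0 => [|j j1j].
    rewrite hornerZ horner_prod => /eqP; rewrite mulf_eq0 => /orP[//|].
    rewrite prodf_seq_eq0 => /hasP [i _ /andP [ij1]].
    rewrite hornerXsubC subr_eq0 nth_uniq ?sz // eq_sym val_eqE.
    by rewrite (negPf ij1).
  rewrite hornerZ horner_prod (bigD1 j1) 1?eq_sym //= hornerXsubC subrr.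
  by rewrite mul0r mulr0.
pose D j := \prod_(i < k.+1 | i != j) (x - (s`_i)%:A).
have -> : horner_alg x q = \sum_(j < k.+1)
    - ((v 0 j)%:A * D j) * (y s`_j * (x - (s`_j)%:A) - 1).
  have D0 : (\prod_(i < k.+1) (x - (s`_i)%:A)) * (\sum_(j < k.+1) v 0 j *: y s`_j) = 0.
    by rewrite vy mulr0.
  rewrite big_distrr /= in D0.
  rewrite raddf_sum -[RHS]addr0 -[X in _ = _ + X]D0 -big_split; apply: eq_bigr => j _ /=.
  rewrite linearZ rmorph_prod [X in _ = _ + X * _](bigD1 j) //= -/(D j).
  rewrite (eq_bigr (fun i : 'I_k.+1 => x - (s`_i)%:A)) => [|i _]; last first.
    by rewrite rmorphB /= horner_algX horner_algC.
  by rewrite -[_ *: y _]mulr_algl -/(D j); ring.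
apply: (big_ind M) => [||j _]; [exact: ideal0|exact: idealD|].
exact: idealM.
Qed.

Lemma scalar_mem a : M a%:A -> a = 0.
Proof.
move=> Ma; apply/eqP/negP => /negP a0; apply: (prime1 M_prime).
have := idealM M_ideal (a^-1)%:A Ma.
by rewrite -scalerAl mul1r scalerA mulVf // scale1r.
Qed.

(** The relation q of x splits over the complex numbers, and q^2, the product of
    q and its conjugate, is a product of real polynomials
    (X - Re z)^2 + (Im z)^2. One of them vanishes at x, M being prime. *)
Lemma quadratic_mod_maximal x :
  exists a b : R, M ((x - a%:A) ^+ 2 + b%:A ^+ 2).
Proof.
have [q q0 Mq] := algebraic_mod_maximal x.
have [r hr] := closed_field_poly_normal (map_poly (real_complex R) q).
pose quad (z : R[i]) : {poly R} := ('X - (complex.Re z)%:P) ^+ 2 + (complex.Im z)%:P ^+ 2.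
have q2 : q ^+ 2 = (lead_coef q ^+ 2)%:P * \prod_(z <- r) quad z.
  apply: (map_poly_inj (real_complex R)).
  pose qC := map_poly (real_complex R) q; pose l := real_complex R (lead_coef q).
  have lE : lead_coef qC = l by apply: lead_coef_map.
  have qC1 : qC = l%:P * \prod_(z <- r) ('X - z%:P) by rewrite [LHS]hr lE mul_polyC.
  have qC2 : qC = l%:P * \prod_(z <- r) ('X - (conjc z)%:P).
    have -> : qC = map_poly conjc qC.
      by rewrite -map_poly_comp; apply: eq_map_poly => c /=; rewrite oppr0.
    rewrite {1}qC1 rmorphM rmorph_prod /= map_polyC /= oppr0; congr (_ * _).
    by apply: eq_bigr => z _; rewrite rmorphB /= map_polyX map_polyC.
  rewrite rmorphXn /= -/qC expr2 {1}qC1 qC2 mulrACA rmorphM /= map_polyC.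
  rewrite -[_ (lead_coef q ^+ 2)]/(real_complex R (lead_coef q ^+ 2)).
  rewrite (rmorphXn (real_complex R)) -/l expr2.
  rewrite polyCM -big_split rmorph_prod; congr (_ * _); apply: eq_bigr => -[a b] _.
  rewrite /quad rmorphD !rmorphXn rmorphB /= map_polyX !map_polyC /=.
  have sum_conj : (a +i* b)%C + (a -i* b)%C = (a%:C + a%:C)%C :> R[i].
    by apply/eqP; rewrite eq_complex /= subrr addr0 !eqxx.
  have prod_conj : (a +i* b)%C * (a -i* b)%C = (a%:C ^+ 2 + b%:C ^+ 2)%C :> R[i].
    rewrite !expr2; apply/eqP; rewrite eq_complex /=.
    by apply/andP; split; apply/eqP; ring.
  rewrite -[RHS](_ : 'X ^+ 2 - (a%:C + a%:C)%C%:P * 'X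
                       + (a%:C ^+ 2 + b%:C ^+ 2)%C%:P = _).
    by rewrite -sum_conj -prod_conj polyCD polyCM; ring.
  by rewrite !polyCD !polyCM; ring.
have : M (horner_alg x (q ^+ 2)) by rewrite rmorphXn; apply: idealM.
rewrite q2 rmorphM /= horner_algC rmorph_prod => /(primeM M_prime) [/scalar_mem|].
  by move/eqP; rewrite expf_eq0 lead_coef_eq0 (negPf q0).
move=> /(prime_prod M_prime) [z _]; rewrite /quad.
rewrite rmorphD !rmorphXn rmorphB /= horner_algX !horner_algC => Mz.
by exists (complex.Re z), (complex.Im z).
Qed.

(** An element that is not congruent to a real number provides, through its
    quadratic relation, a square root i of - 1 modulo M. Then every quadratic
    relation factors, so every element is a + g i modulo M with a and g real, and
    complex numbers have square roots. *)
Lemma square_mod_maximal : (exists x, forall a : R, ~ M (x - a%:A)) ->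
  forall x, exists c, M (c ^+ 2 - x).
Proof.
move=> [w hw] x.
have [i Mi] : exists i, M (i ^+ 2 + 1).
  have [a [b Mab]] := quadratic_mod_maximal w.
  have b0 : b != 0.
    apply/eqP => b0; move: Mab; rewrite b0 scale0r expr0n addr0 expr2.
    by case/(primeM M_prime); apply: hw.
  exists ((b^-1)%:A * (w - a%:A)).
  have bV : (b^-1)%:A * b%:A = 1 :> A.
    by rewrite -scalerAl mul1r scalerA mulVf // scale1r.
  have := idealM M_ideal ((b^-1)%:A ^+ 2) Mab; congr M.
  by rewrite mulrDr -!exprMn bV expr1n.
have [g [a Mg]] : exists g a : R, M (x - (a%:A + g%:A * i)).
  have [a [b Mab]] := quadratic_mod_maximal x.
  have : M ((x - (a%:A + b%:A * i)) * (x - (a%:A + (- b)%:A * i))).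
    have := idealD M_ideal Mab (idealM M_ideal (- b%:A ^+ 2) Mi); congr M.
    by rewrite scaleNr; ring.
  by case/(primeM M_prime) => ?; [exists b, a|exists (- b), a].
pose z := sqrtc (Complex a g).
have : z ^+ 2 = Complex a g by apply: sqr_sqrtc.
case: z => u v; rewrite expr2 => -[eq_a eq_g].
exists (u%:A + v%:A * i).
have := idealD M_ideal (idealM M_ideal (-1) Mg) (idealM M_ideal (v%:A ^+ 2) Mi).
congr M; rewrite -eq_a -eq_g !(scalerDl, scaleNr) !scalarM; ring.
Qed.
End Maximal.
End Algebra.

(** * Height and general position *)

Section Height.
Variable A : comNzRingType.
Implicit Types (I J P : set A).

Lemma prime_idealrP P : is_prime P ->
  exists p : prime_idealr A, forall x, (x \in p) = `[< P x >].
Proof.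
move=> P_prime; have P_ideal := prime_ideal P_prime.
pose S : A -> bool := fun x => `[< P x >].
have S_ideal : idealr_closed S.
  split=> [||a x y /asboolP Px /asboolP Py].
  - by apply/asboolP; apply: ideal0.
  - by apply/negP => /asboolP /(prime1 P_prime).
  - by apply/asboolP; apply: idealD => //; apply: idealM.
have S_prime : prime_idealr_closed S.
  move=> x y /asboolP /(primeM P_prime) [Px|Py].
    by apply/orP; left; apply/asboolP.
  by apply/orP; right; apply/asboolP.
pose B := isIdealr.Build A S S_ideal.
pose C := isPrimeIdealrClosed.Build A S S_prime.
pose p : prime_idealr A := HB.pack S B C.
by exists p.
Qed.

Lemma prime_idealr_prime (p : prime_idealr A) : is_prime [set x | x \in p].
Proof.
split=> [||x y /=]; first split=> [|x y|a x] /=.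
- exact: rpred0.
- exact: rpredD.
- exact: idealMr.
- by rewrite /= idealr1.
- by rewrite prime_idealrM => /orP.
Qed.

(** [prime_height_ge] by recursion from the top of the chain. *)
Fixpoint height_at_least (n : nat) P : Prop :=
  if n is n'.+1 then
    is_prime P /\ exists Q, [/\ height_at_least n' Q, Q `<=` P & ~ (P `<=` Q)]
  else is_prime P.

Lemma height_at_least_chain n P : height_at_least n P ->
  exists Q : nat -> prime_idealr A,
    prime_chain n Q /\ forall x, x \in Q n <-> P x.
Proof.
elim: n P => [|n IHn] P /=.
  move=> /prime_idealrP [p hp]; exists (fun=> p); split=> // x.
  by rewrite hp; split=> /asboolP.
move=> [/prime_idealrP [p hp] [Q [/IHn [q [q_chain qn]] QP nPQ]]].
exists (fun i => if (i <= n)%N then q i else p); split=> [i|x]; last first.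
  by rewrite ltnn hp; split=> /asboolP.
rewrite ltnS; case: ltngtP => // [lt_in _|-> _]; first exact: q_chain.
split=> [x /qn Qx|pq]; first by rewrite hp; apply/asboolP/QP.
by apply: nPQ => x Px; apply/qn/pq; rewrite hp; apply/asboolP.
Qed.

Lemma height_le_dim d n P : krull_dim A d -> height_at_least n P -> (n <= d)%N.
Proof. by move=> [_ dim] /height_at_least_chain [Q [/dim]]. Qed.

Lemma height_ge1 J P : height_ge J 1 -> is_prime P -> J `<=` P -> height_at_least 1 P.
Proof.
move=> hJ P_prime JP; have [p hp] := prime_idealrP P_prime.
have /hJ [q [/(_ 0%N isT) [q01 q10] q1]] : forall x, J x -> x \in p.
  by move=> x /JP Px; rewrite hp; apply/asboolP.
split=> //; exists [set x | x \in q 0%N]; split=> /= [|x q0x|Pq].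
- exact: prime_idealr_prime.
- by apply/asboolP; rewrite -hp -q1; apply: q01.
- by apply: q10 => x; rewrite q1 hp => /asboolP /Pq.
Qed.

Definition ideal_sum I J : set A := [set z | exists x y, [/\ I x, J y & z = x + y]].

Lemma ideal_sum_ideal I J : is_ideal I -> is_ideal J -> is_ideal (ideal_sum I J).
Proof.
move=> hI hJ; split=> [|_ _ [x [y [Ix Jy ->]]] [z [w [Iz Jw ->]]]|a _ [x [y [Ix Jy ->]]]].
- by exists 0, 0; rewrite addr0; split=> //; apply: ideal0.
- by exists (x + z), (y + w); rewrite addrACA; split=> //; apply: idealD.
- by exists (a * x), (a * y); rewrite mulrDr; split=> //; apply: idealM.
Qed.

(** Each prime excludes at most one m: the difference of two bad values is e up
    to a unit. *)
Lemma avoid_primes (n : nat) (P : nat -> set A) (e t : A) :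
  (forall m : nat, (0 < m)%N -> exists r : A, m%:R * r = 1) ->
  (forall i, (i < n)%N -> is_prime (P i)) ->
  exists N, forall m, (N <= m)%N -> forall i, (i < n)%N ->
    ~ P i e -> ~ P i (t + e * m%:R).
Proof.
move=> nat_unit; elim: n => [|n IHn] P_prime; first by exists 0%N.
have [N hN] := IHn (fun i lt_in => P_prime i (ltnW lt_in)).
have Pn_prime := P_prime n (ltnSn n).
suff [N' hN'] : exists N', forall m, (N' <= m)%N -> ~ P n e -> ~ P n (t + e * m%:R).
  exists (maxn N N') => m; rewrite geq_max => /andP [/hN le /hN' le'] i.
  by rewrite ltnS leq_eqVlt => /orP [/eqP ->|] //; apply: le.
have [[m0 Pm0]|noP] := pselect (exists m, P n (t + e * m%:R)); last first.
  by exists 0%N => m _ _ Pm; apply: noP; exists m.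
exists m0.+1 => m lt_m nPe Pm; apply: nPe.
have [r hr] : exists r : A, (m - m0)%:R * r = 1 by apply: nat_unit; rewrite subn_gt0.
have Pn_ideal := prime_ideal Pn_prime.
have := idealM Pn_ideal r (idealD Pn_ideal Pm (idealM Pn_ideal (-1) Pm0)).
have eE : e = e * ((m%:R - m0%:R) * r).
  by rewrite -natrB ?(ltnW lt_m) // hr mulr1.
by congr (P n); rewrite [RHS]eE; ring.
Qed.

(** The multiplier k d keeps the new entry out of the primes avoiding e that are
    minimal over the previous entries, or minimal over the previous entries and J.
    A prime that avoids e and contains all the entries strictly contains one of
    them, so each entry raises the height by one. For the primes over J the count
    starts at one instead of zero. *)
Lemma general_position J e (t : nat -> A) (d : nat) : noetherian A ->
  (forall m : nat, (0 < m)%N -> exists r : A, m%:R * r = 1) ->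
  is_ideal J -> (forall P, is_prime P -> J `<=` P -> height_at_least 1 P) ->
  exists k : nat -> nat, forall P, is_prime P -> ~ P e ->
    (forall j, (j < d)%N -> P (t j + e * (k j)%:R)) ->
    height_at_least d P /\ (J `<=` P -> height_at_least d.+1 P).
Proof.
move=> noethA nat_unit J_ideal J_height; elim: d => [|d [k IHd]].
  by exists (fun=> 0%N) => P P_prime _ _; split=> // /(J_height _ P_prime).
pose I := generated (fun j => t j + e * (k j)%:R) d.
have I_ideal : is_ideal I by apply: generated_ideal.
have It j : (j < d)%N -> I (t j + e * (k j)%:R).
  exact: (generated_mem (fun j => t j + e * (k j)%:R)).
have [n [Q [hQ Qmin]]] := finitely_many_minimal_primes noethA I_ideal.
have [n' [Q' [hQ' Qmin']]] :=
  finitely_many_minimal_primes noethA (ideal_sum_ideal I_ideal J_ideal).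
have sum_l : I `<=` ideal_sum I J.
  by move=> x Ix; exists x, 0; rewrite addr0; split=> //; apply: ideal0.
have sum_r : J `<=` ideal_sum I J.
  by move=> x Jx; exists 0, x; rewrite add0r; split=> //; apply: ideal0.
have [N hN] := avoid_primes e (t d) nat_unit (fun i h => (hQ i h).1).
have [N' hN'] := avoid_primes e (t d) nat_unit (fun i h => (hQ' i h).1).
pose k' j := if j == d then maxn N N' else k j.
have k'd : k' d = maxn N N' by rewrite /k' eqxx.
exists k' => P P_prime nPe P_t; have P_ideal := prime_ideal P_prime.
have Pd := P_t d (ltnSn d).
have IP : I `<=` P.
  apply: generated_sub => // j lt_jd; have := P_t j (ltnW lt_jd).
  by rewrite /k' ltn_eqF.
split.
  have [i lt_in QP] := Qmin P P_prime IP.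
  have [Qi_prime IQ] := hQ i lt_in.
  have nQe : ~ Q i e by move=> /QP.
  split=> //; exists (Q i); split=> //.
    by have [] := IHd _ Qi_prime nQe (fun j h => IQ _ (It j h)).
  by move=> /(_ _ Pd); apply: hN => //; rewrite k'd leq_maxl.
move=> JP; have sumP : ideal_sum I J `<=` P.
  by move=> _ [x [y [/IP Px /JP Py ->]]]; apply: idealD.
have [i lt_in QP] := Qmin' P P_prime sumP.
have [Qi_prime IQ] := hQ' i lt_in.
have nQe : ~ Q' i e by move=> /QP.
split=> //; exists (Q' i); split=> //.
  have [_] := IHd _ Qi_prime nQe (fun j h => IQ _ (sum_l _ (It j h))).
  by apply=> x /sum_r /IQ.
by move=> /(_ _ Pd); apply: hN' => //; rewrite k'd leq_maxr.
Qed.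
End Height.

(** * Square roots modulo an ideal *)

Section Squares.
Variable A : comNzRingType.
Hypothesis noethA : noetherian A.
Implicit Types (I P : set A).

Lemma exp_congr I x y n : is_ideal I -> I (x ^+ n) -> I y -> I ((x + y) ^+ n).
Proof.
move=> I_ideal Ix Iy; rewrite -[_ ^+ n](subrK (x ^+ n)); apply: idealD => //.
by rewrite subrXX addrC addKr mulrC; apply: idealM.
Qed.

(** Newton's iteration for X^2 - a: it replaces the error D by (D / (2 c))^2
    modulo I, and c is invertible modulo I since a is and D is nilpotent. Here
    h stands for 1 / 2. *)
Lemma square_lift I (a a' h c : A) k : is_ideal I -> h + h = 1 ->
  I (a * a' - 1) -> I ((c ^+ 2 - a) ^+ (2 ^ k)) -> exists c', I (c' ^+ 2 - a).
Proof.
move=> I_ideal h2 Ia; elim: k c => [|k IHk] c; first by exists c.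
set D := c ^+ 2 - a => ID.
(* A prime containing I and c would contain D, hence a. *)
have [y [v [Iy yv]]] : adjoin I c 1.
  apply: contrapT => /(proper_ideal_in_prime noethA (adjoin_ideal c I_ideal)).
  move=> [P P_prime IP]; have P_ideal := prime_ideal P_prime.
  apply: (prime1 P_prime).
  have Pc : P c by apply/IP/adjoin_mem.
  have PD : P D.
    by apply: (primeX (n := (2 ^ k.+1)%N) P_prime); apply/IP/adjoin_sub.
  have Paa : P (a * a' - 1) by apply/IP/adjoin_sub.
  have := idealD P_ideal (idealM P_ideal (c * a') Pc)
    (idealM P_ideal (-1) (idealD P_ideal Paa (idealM P_ideal a' PD))).
  by congr P; rewrite /D; ring.
apply: (IHk (c - h * v * D)).
have -> : (c - h * v * D) ^+ 2 - a = (h * v * D) ^+ 2 + D * y.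
  have -> : y = 1 - v * c by rewrite yv addrK.
  transitivity ((h * v * D) ^+ 2 + D * (1 - v * c) + D * v * c * (1 - (h + h))).
    by rewrite /D; ring.
  by rewrite h2 subrr mulr0 addr0.
apply: exp_congr => //; last by apply: idealM.
by rewrite -exprM -expnS exprMn; apply: idealM.
Qed.

(** Chinese remainders for maximal ideals, one at a time. If P n contains an
    earlier P i, nothing has to be done; otherwise some G in all the earlier ones
    is a unit modulo P n. *)
Lemma square_mod_primes (n : nat) (P : nat -> set A) (a : A) :
  (forall i, (i < n)%N -> is_prime (P i)) ->
  (forall i, (i < n)%N -> forall x, ~ P i x -> exists y, P i (y * x - 1)) ->
  (forall i, (i < n)%N -> exists c, P i (c ^+ 2 - a)) ->
  exists c, forall i, (i < n)%N -> P i (c ^+ 2 - a).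
Proof.
move=> P_prime P_max P_sq.
elim: n P_prime P_max P_sq => [|n IHn] P_prime P_max P_sq; first by exists 0.
have [|||c hc] := IHn; try by move=> i lt_in; auto.
have Pn_prime := P_prime n (ltnSn n); have Pn_max := P_max n (ltnSn n).
have [b hb] := P_sq n (ltnSn n).
have [[i [lt_in PiPn]]|noP] := pselect (exists i, (i < n)%N /\ P i `<=` P n).
  exists c => j; rewrite ltnS leq_eqVlt => /orP [/eqP ->|/hc //].
  by apply: PiPn; apply: hc.
have g_ex i : exists x, (i < n)%N -> P i x /\ ~ P n x.
  case: (ltnP i n) => [lt_in|]; last by exists 0.
  apply: contrapT => /forallNP no_g; apply: noP; exists i; split=> // x Px.
  by apply: contrapT => nPn; apply: (no_g x).
have [g hg] := choice g_ex.
pose G := \prod_(i < n) g i.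
have PG i : (i < n)%N -> P i G.
  move=> lt_in; rewrite /G (bigD1 (Ordinal lt_in)) //= mulrC.
  by apply: idealM; [apply: prime_ideal; apply/P_prime/ltnW | case: (hg i lt_in)].
have nPnG : ~ P n G.
  move=> /(prime_prod Pn_prime) [i _]; by case: (hg i (ltn_ord i)).
have [y hy] := Pn_max _ nPnG.
exists (c + y * G * (b - c)) => j; rewrite ltnS leq_eqVlt => /orP [/eqP ->|lt_jn].
  have Pn_ideal := prime_ideal Pn_prime.
  have := idealD Pn_ideal hb (idealM Pn_ideal ((b - c) * (b + (c + y * G * (b - c)))) hy).
  by congr (P n); ring.
have Pj_ideal := prime_ideal (P_prime j (ltnW lt_jn)).
have := idealD Pj_ideal (hc j lt_jn) (idealM Pj_ideal
  (y * (b - c) * (c + (c + y * G * (b - c)))) (PG j lt_jn)).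
by congr (P j); ring.
Qed.

(** A square root modulo the radical of I, the intersection of finitely many
    maximal ideals, lifts to a square root modulo I. *)
Lemma square_mod_ideal I (a a' h : A) : is_ideal I -> h + h = 1 -> I (a * a' - 1) ->
  (forall P, is_prime P -> I `<=` P -> forall x, ~ P x -> exists y, P (y * x - 1)) ->
  (forall P, is_prime P -> I `<=` P -> exists c, P (c ^+ 2 - a)) ->
  exists c, I (c ^+ 2 - a).
Proof.
move=> I_ideal h2 Ia P_max P_sq.
have [n [P [hP Pmin]]] := finitely_many_minimal_primes noethA I_ideal.
have [|||c hc] := @square_mod_primes n P a.
- by move=> i /hP [].
- by move=> i /hP [? ?]; apply: P_max.
- by move=> i /hP [? ?]; apply: P_sq.
have [k Ik] : exists k, I ((c ^+ 2 - a) ^+ k).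
  apply: (noetherian_nilpotent noethA I_ideal) => Q Q_prime IQ.
  by have [i lt_in] := Pmin Q Q_prime IQ; apply; apply: hc.
apply: (square_lift (c := c) (k := k) I_ideal h2 Ia).
by rewrite -(subnK (ltnW (ltn_expl k (ltnSn 1)))) exprD; apply: idealM.
Qed.
End Squares.

(** * Real maximal ideals *)

Section RealIdeals.
Variables (R : realType) (A : comAlgType R) (M : set A).
Hypothesis M_prime : is_prime M.
Hypothesis M_max : forall x, ~ M x -> exists y, M (y * x - 1).
Hypothesis M_value : forall x, exists a : R, M (x - a%:A).
Let M_ideal := prime_ideal M_prime.

(** The value of x is unique, so it depends on x as a ring morphism; on A / M it
    is the isomorphism onto R. *)
Lemma real_maximal_of_values :
  exists2 m : idealr A, (forall x, x \in m <-> M x) & real_maximal_ideal m.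
Proof.
have [p hp] := prime_idealrP M_prime.
pose m : idealr A := p.
have mM x : x \in m <-> M x by rewrite [x \in m]hp; split=> /asboolP.
exists m => //; split.
  move=> I mI x Ix; apply/mM; apply: contrapT => /M_max [y /mM /mI hy].
  have := idealr1 I; suff -> : 1 \in I by [].
  by rewrite -[1](subKr (y * x)) rpredB // idealMr.
have [value hv] := choice M_value.
have value_eq x a : M (x - a%:A) -> value x = a.
  move=> Ma; apply/eqP; rewrite -subr_eq0; apply/eqP/(scalar_mem M_prime).
  have := idealD M_ideal Ma (idealM M_ideal (-1) (hv x)); congr M.
  by rewrite scalerBl; ring.
pose f (q : {ideal_quot m}) := value (repr q).
pose pi := \pi_({ideal_quot m}).
have fpi x : f (pi x) = value x.
  apply: value_eq.
  have /mM Mrepr : repr (pi x) - x \in m.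
    by rewrite Quotient.idealrBE reprK.
  by have := idealD M_ideal Mrepr (hv x); congr M; ring.
have valueB x y : value (x - y) = value x - value y.
  apply: value_eq.
  have := idealD M_ideal (hv x) (idealM M_ideal (-1) (hv y)); congr M.
  by rewrite scalerBl; ring.
have valueM x y : value (x * y) = value x * value y.
  apply: value_eq.
  have := idealD M_ideal (idealM M_ideal y (hv x)) (idealM M_ideal (value x)%:A (hv y)).
  by congr M; rewrite scalarM; ring.
have value1 : value 1 = 1.
  by apply: value_eq; rewrite scale1r subrr; apply: ideal0.
have piK (u : {ideal_quot m}) : pi (repr u) = u by apply: reprK.
have f_zmod : zmod_morphism f.
  move=> u v; rewrite -[u]piK -[v]piK -(rmorphB pi) !fpi.
  exact: valueB.
have f_monoid : monoid_morphism f.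
  split=> [|u v]; first by rewrite -(rmorph1 pi) fpi.
  by rewrite -[u]piK -[v]piK -(rmorphM pi) !fpi.
pose F1 := GRing.isZmodMorphism.Build _ _ f f_zmod.
pose F2 := GRing.isMonoidMorphism.Build _ _ f f_monoid.
pose F : {rmorphism {ideal_quot m} -> R} := HB.pack f F1 F2.
exists F, (fun a => pi a%:A) => [u|a] /=; last first.
  by rewrite [LHS]fpi; apply: value_eq; rewrite subrr; apply: ideal0.
rewrite -{2}[u]piK; apply/eqP; rewrite eq_sym -[_ == _]Quotient.idealrBE.
exact/mM/hv.
Qed.
End RealIdeals.

(** * Square roots modulo the tail of a row *)

(** In general position the primes P over the entries have height d. So they are
    maximal, and none of them contains the intersection of the real maximal
    ideals, which would give it height d + 1. Hence none is real, the residue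
    fields are complex, and all their elements are squares. *)
Lemma square_modulo_row (R : realType) (A : comAlgType R) (d : nat) :
  finitely_generated_algebra A -> krull_dim A d ->
  height_ge (real_maximal_intersection A) 1 ->
  forall (a b : A) (t : 'rV[A]_d), Um (row_cons (a * b) t) ->
  exists u c w, c ^+ 2 = a + dot (t + (a * b) *: u) w.
Proof.
move=> A_fg A_dim A_real a b t; set e := a * b => /Um_cons [p [w hw]].
pose J := real_maximal_intersection A.
have noethA := noetherian_fg_algebra A_fg.
have J_ideal : is_ideal J.
  split=> [m _|x y Jx Jy m hm|r x Jx m hm]; first exact: rpred0.
  - by rewrite rpredD ?Jx ?Jy.
  - by rewrite idealMr ?Jx.
(* The integers needed for general position are invertible real numbers. *)
have nat_unit m : (0 < m)%N -> exists r : A, m%:R * r = 1.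
  move=> m_gt0; exists (m%:R^-1)%:A.
  by rewrite -scaler_nat -scalerAl mul1r scalerA mulfV ?scale1r // pnatr_eq0 -lt0n.
have [k hk] := general_position e (fun j => if insub j is Some i then t 0 i else 0)
  d noethA nat_unit J_ideal (fun P => @height_ge1 A J P A_real).
pose u : 'rV[A]_d := \row_j (k j)%:R.
pose I := entry_ideal (t + e *: u).
have I_ideal : is_ideal I by apply: entry_ideal_is_ideal.
have Ie : I (e * (p - dot u w) - 1).
  by exists (- w); rewrite dotC -scaleN1r dotZl mulN1r dotC dotDl dotZl -hw; ring.
have P_height P : is_prime P -> I `<=` P ->
    height_at_least d P /\ (J `<=` P -> height_at_least d.+1 P).
  move=> P_prime IP; have P_ideal := prime_ideal P_prime.
  apply: hk => // [Pe|j lt_jd].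
    apply: (prime1 P_prime).
    have := idealD P_ideal (idealM P_ideal (p - dot u w) Pe)
      (idealM P_ideal (-1) (IP _ Ie)).
    by congr P; ring.
  apply: IP; exists (delta_mx 0 (Ordinal lt_jd)).
  by rewrite dot_delta insubT !mxE.
have P_max P : is_prime P -> I `<=` P -> forall x, ~ P x -> exists y, P (y * x - 1).
  move=> P_prime IP x nPx; have P_ideal := prime_ideal P_prime.
  have [[y [v [Py yv]]]|Q_proper] := pselect (adjoin P x 1).
    have yE : y = 1 - v * x by rewrite yv addrK.
    by exists v; have := idealM P_ideal (-1) Py; congr P; rewrite yE; ring.
  have [Q Q_prime xPQ] := proper_ideal_in_prime noethA (adjoin_ideal x P_ideal) Q_proper.
  suff /(height_le_dim A_dim) : height_at_least d.+1 Q by rewrite ltnn.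
  split=> //; exists P; split; first by case: (P_height P P_prime IP).
    by move=> z /(@adjoin_sub A P x) /xPQ.
  by move=> QP; apply: nPx; apply/QP/xPQ/adjoin_mem.
have P_square P : is_prime P -> I `<=` P -> exists c, P (c ^+ 2 - a).
  move=> P_prime IP; apply: (square_mod_maximal P_prime (P_max P P_prime IP) A_fg).
  apply: contrapT => no_x.
  have P_value x : exists r : R, P (x - r%:A).
    by apply: contrapT => /forallNP hx; apply: no_x; exists x.
  have [m mP m_real] := real_maximal_of_values P_prime (P_max P P_prime IP) P_value.
  have [_ /(_ _) hJ] := P_height P P_prime IP.
  suff /hJ /(height_le_dim A_dim) : J `<=` P by rewrite ltnn.
  by move=> x /(_ m m_real) /mP.
have half : (2%:R^-1)%:A + (2%:R^-1)%:A = 1 :> A.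
  by rewrite -scalerDl -mulr2n -[_ *+ 2]mulr_natr mulVf ?scale1r ?pnatr_eq0.
have [|c [v cv]] := square_mod_ideal (a' := b * (p - dot u w))
  noethA I_ideal half _ P_max P_square.
  by rewrite mulrA.
by exists u, c, v; rewrite cv addrC subrK.
Qed.

(** * Mennicke and weak Mennicke symbols *)

Section SymbolTranslation.
Variables (A : comNzRingType) (n : nat).

(** The Mennicke relation moves the last entry and the weak one the first entry;
    this signed exchange translates between them. *)
Lemma symbol_rcons (G : Type) (phi : 'rV[A]_n.+2 -> G) :
  (forall v e, Um v -> elementary_group e -> phi v = phi (v *m e)) ->
  forall b (t : 'rV[A]_n) x, Um (row_rcons (row_cons b t) x) ->
  Um (row_cons x (row_rcons t (- b))) /\
  phi (row_rcons (row_cons b t) x) = phi (row_cons x (row_rcons t (- b))).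
Proof. by move=> phi_inv b t x; rewrite row_rcons_cons; apply: symbol_swap. Qed.

Lemma symbol_cons (G : Type) (phi : 'rV[A]_n.+2 -> G) :
  (forall v e, Um v -> elementary_group e -> phi v = phi (v *m e)) ->
  forall b (t : 'rV[A]_n) x, Um (row_cons x (row_rcons t b)) ->
  Um (row_rcons (row_cons (- b) t) x) /\
  phi (row_cons x (row_rcons t b)) = phi (row_rcons (row_cons (- b) t) x).
Proof.
move=> phi_inv b t x U; rewrite row_rcons_cons.
(* The signed exchange has order four, so its cube is its inverse. *)
have [U1 ->] := symbol_swap phi_inv U; have [U2 ->] := symbol_swap phi_inv U1.
have [U3 ->] := symbol_swap phi_inv U2.
by rewrite opprK in U3 *.
Qed.

Lemma Um_unit_row m : Um (row_cons 1 0 : 'rV[A]_m.+1).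
Proof. by apply/Um_cons; exists 1, 0; rewrite mulr1 dot0r addr0. Qed.

Lemma zero_row_rcons m : 0 = row_rcons 0 0 :> 'rV[A]_m.+1.
Proof. by apply/rowP => i; rewrite !mxE; case: unlift => [j|]; rewrite ?mxE. Qed.

Lemma zero_row_cons m : 0 = row_cons 0 0 :> 'rV[A]_m.+1.
Proof. by apply/rowP => i; rewrite !mxE; case: unlift => [j|]; rewrite ?mxE. Qed.

Lemma Mennicke_symbol_weak (G : groupType) (phi : 'rV[A]_n.+2 -> G) :
  Mennicke_symbol phi -> weak_Mennicke_symbol phi.
Proof.
move=> [phi1 phi_inv phiM]; split=> // [|a t].
  have := Um_unit_row n.+1; rewrite zero_row_rcons => U.
  have [_ ->] := symbol_cons phi_inv U; rewrite -phi1 oppr0.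
  by rewrite -zero_row_cons.
have [t' [b ->]] : exists t' b, t = row_rcons t' b.
  by do 2!eexists; apply: row_rconsE.
move=> U U'; have UM := Um_mul U U'.
have [V ->] := symbol_cons phi_inv U; have [V' ->] := symbol_cons phi_inv U'.
have [_ ->] := symbol_cons phi_inv UM.
exact: phiM.
Qed.

Lemma nice_symbol_Mennicke (G : groupType) (phi : 'rV[A]_n.+2 -> G) :
  weak_Mennicke_symbol phi ->
  (forall a b t, Um (row_cons a t) -> Um (row_cons b t) ->
    (phi (row_cons a t) * phi (row_cons b t))%g = phi (row_cons (a * b) t)) ->
  Mennicke_symbol phi.
Proof.
move=> [phi1 phi_inv _] phiM; split=> // [|c x y].
  have := Um_unit_row n.+1; rewrite {1}zero_row_rcons => U.
  have [] := symbol_cons phi_inv U.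
  by rewrite -zero_row_rcons oppr0 -zero_row_cons phi1.
have [b [t ->]] := row_consP c; move=> U U'.
have [V ->] := symbol_rcons phi_inv U; have [V' ->] := symbol_rcons phi_inv U'.
have UM : Um (row_rcons (row_cons b t) (x * y)).
  by case: (symbol_cons phi_inv (Um_mul V V')); rewrite opprK.
have [_ ->] := symbol_rcons phi_inv UM.
exact: phiM.
Qed.
End SymbolTranslation.

(** * The nice group structure *)

Theorem theorem4p1 (R : realType) (A : comAlgType R) (d : nat)
  (Afg : finitely_generated_algebra A)
  (d_ge2 : (2 <= d)%N)
  (Adim : krull_dim A d)
  (Areal : (forall m : idealr A, ~ real_maximal_ideal m) \/
           height_ge (real_maximal_intersection A) 1)
  (WMS : groupType) (wms : 'rV[A]_d.+1 -> WMS) (WMSP : is_WMS wms)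
  (MS : groupType) (ms : 'rV[A]_d.+1 -> MS) (MSP : is_MS ms) :
  [/\ (* nice group structure, in the orbit set Um_{d+1}(A) / E_{d+1}(A) *)
      forall star, orbit_group_law wms star ->
      forall (a b : A) (t : 'rV[A]_d),
        Um (row_cons a t) -> Um (row_cons b t) ->
        star (elem_orbit (row_cons a t)) (elem_orbit (row_cons b t))
          = elem_orbit (row_cons (a * b) t),
      (* the same, in WMS_{d+1}(A) *)
      forall (a b : A) (t : 'rV[A]_d),
        Um (row_cons a t) -> Um (row_cons b t) ->
        (wms (row_cons a t) * wms (row_cons b t))%g
          = wms (row_cons (a * b) t)
    & (* the canonical morphism WMS_{d+1}(A) -> MS_{d+1}(A) is bijective *)
      exists f : {multiplicative WMS -> MS},
        (forall v, Um v -> f (wms v) = ms v) /\ bijective f].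
Proof.
have A_real : height_ge (real_maximal_intersection A) 1.
  case: Areal => // no_real p Jp; have := idealr1 p.
  by rewrite Jp // => m /no_real.
case: d d_ge2 => [|[|m]] // _ in Adim wms WMSP ms MSP *.
have [wms_weak wms_univ] := WMSP; have [ms_Mennicke ms_univ] := MSP.
have [_ wms_inv _] := wms_weak.
have wmsM a b t : Um (row_cons a t) -> Um (row_cons b t) ->
    (wms (row_cons a t) * wms (row_cons b t))%g = wms (row_cons (a * b) t).
  move=> Ua Ub; have Uab := Um_mul Ua Ub.
  (* Adding multiples of a b to t is elementary for each of the first entries
     a, b and a b, and for the new t' the entry a may be replaced by c^2. *)
  have [u [c [w cE]]] := square_modulo_row Afg Adim A_real Uab.
  set t' := t + (a * b) *: u in cE.
  have ta : t' = t + a *: (b *: u) by rewrite scalerA.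
  have tb : t' = t + b *: (a *: u) by rewrite scalerA mulrC.
  have [Ua' ->] := symbol_tail wms_inv (b *: u) Ua; rewrite -ta in Ua' *.
  have [Ub' ->] := symbol_tail wms_inv (a *: u) Ub; rewrite -tb in Ub' *.
  have [Uab' ->] := symbol_tail wms_inv u Uab; rewrite -/t' in Uab' *.
  have [Uc ->] := symbol_head wms_inv w Ua'; rewrite -cE in Uc *.
  rewrite (weak_Mennicke_square wms_weak Uc Ub').
  have [_ ->] := symbol_head wms_inv (b *: w) Uab'.
  congr (wms (row_cons _ _)).
  by rewrite [dot _ (b *: w)]dotC dotZl [dot w _]dotC cE; ring.
split=> // [star [f [[_ f_inj _] fE f_star]] a b t Ua Ub|].
  have orb (v : 'rV[A]_m.+3) : Um v -> orbit_set (elem_orbit v) by move=> Uv; exists v.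
  have [orb_star star_E] := f_star _ _ (orb _ Ua) (orb _ Ub).
  apply: f_inj; rewrite ?inE //; first exact/orb/Um_mul.
  by rewrite star_E !fE ?wmsM //; apply: Um_mul.
have wms_Mennicke := nice_symbol_Mennicke wms_weak wmsM.
have ms_weak := Mennicke_symbol_weak ms_Mennicke.
(* Both universal symbols now satisfy both sets of relations. *)
have [f [fE _]] := wms_univ _ _ ms_weak.
have [g [gE _]] := ms_univ _ _ wms_Mennicke.
exists f; split=> //; exists g => x.
  have [h [_ h_uniq]] := wms_univ _ _ wms_weak.
  have idE := h_uniq (idfun : {multiplicative WMS -> WMS}) (fun _ _ => erefl).
  have -> : g (f x) = (g \o f : {multiplicative WMS -> WMS}) x by [].
  by rewrite h_uniq -?idE // => v Uv /=; rewrite fE ?gE.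
have [h [_ h_uniq]] := ms_univ _ _ ms_Mennicke.
have idE := h_uniq (idfun : {multiplicative MS -> MS}) (fun _ _ => erefl).
have -> : f (g x) = (f \o g : {multiplicative MS -> MS}) x by [].
by rewrite h_uniq -?idE // => v Uv /=; rewrite gE ?fE.
Qed.
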